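(* Let $\varepsilon=\varepsilon_n>0$ and $\lambda=\lambda_n>0$ be parameters (which may depend on $n$), and for integers $n\ge 1$, $k\ge 0$ let $S^{\varepsilon}(n,n+k)$ denote the expected total number of $\varepsilon$-stable matchings between $n$ firms and $n+k$ workers in the random model described in the context. As $n\to\infty$: (i) If $\varepsilon\lambda=O(n^{-1}\log n)$, then $S^{\varepsilon}(n,n+k)$ is polynomially large, uniformly over $k\ge 0$; that is, $S^{\varepsilon}(n,n+k)\le \exp(O(\log n))$ uniformly over $k\ge 0$: there exist constants $K>0$ and $n_0$ such that $S^{\varepsilon}(n,n+k)\le n^{K}$ for all $n\ge n_0$ and all integers $k\ge 0$. (ii) If $\varepsilon\lambda=\omega(n^{-1}\log n)$, i.e. $\varepsilon_n\lambda_n\, n/\log n\to\infty$, then $S^{\varepsilon}(n,n+k)$ is super-polynomially large, uniformly over $k\ge 0$; that is, for every $K>0$ there exists $n_0$ such that $S^{\varepsilon}(n,n+k)\ge n^{K}$ for all $n\ge n_0$ and all integers $k\ge 0$.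
   Context: There are $n$ firms, indexed by $i\in[n]=\{1,\dots,n\}$, and $n+k$ workers, indexed by $j\in[n+k]$, with $k\ge 0$. Let $X_{i,j}$ and $Y_{i,j}$, $i\in[n]$, $j\in[n+k]$, be $2n(n+k)$ mutually independent random variables, each uniformly distributed on $[0,1]$. Firm $i$ ranks the workers in increasing order of $X_{i,j}$ (over $j$), and worker $j$ ranks the firms in increasing order of $Y_{i,j}$ (over $i$), smaller values being more preferred. For a parameter $\lambda>0$, the utility for firm $i$ associated with worker $j$ is $f(X_{i,j})$ and the utility for worker $j$ associated with firm $i$ is $w(Y_{i,j})$, where $f(z)=w(z)=\frac{1}{\lambda}\log(1/z)$. A matching $M$ is a one-to-one assignment of $n$ of the workers to the $n$ firms, so every firm is matched and exactly $k$ workers are unmatched; there are $(n+k)_n=(n+k)(n+k-1)\cdots(k+1)$ matchings. Write $M(i)$ for the worker matched to firm $i$ and, for a matched worker $j$, write $M(j)$ for the firm matched to worker $j$. Given $\varepsilon>0$, a matching $M$ is called $\varepsilon$-stable if both of the following hold: (a) there is no pair (firm $i$, worker $j$) with worker $j$ matched in $M$ such that $$f(X_{i,j})>f(X_{i,M(i)})+\varepsilon\quad\text{and}\quad w(Y_{i,j})>w(Y_{M(j),j})+\varepsilon;$$ (b) there is no pair (firm $i$, worker $j$) with worker $j$ not matched in $M$ such that $$f(X_{i,j})>f(X_{i,M(i)})+\varepsilon.$$ $S^{\varepsilon}(n,n+k)$ is the expected number of $\varepsilon$-stable matchings $M$. *)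

(* Defs.v *)
From HB Require Import structures.
From mathcomp Require Import all_boot all_order all_algebra.
From mathcomp Require Import all_classical all_reals all_analysis.
Set Implicit Arguments.
Unset Strict Implicit.
Unset Printing Implicit Defensive.
Import Order.TTheory GRing.Theory Num.Theory.
Import numFieldNormedType.Exports.

Local Open Scope classical_set_scope.
Local Open Scope ring_scope.

Definition mutually_independent (d : measure_display) (T : measurableType d)
    (R : realType) (P : probability T R) (I : finType)
    (Z : I -> {RV P >-> R}) : Prop :=
  forall (J : {set I}) (A : I -> set R), (forall i, measurable (A i)) ->
    P (\bigcap_(i in [set` J]) (Z i @^-1` A i))
    = (\prod_(i in J) P (Z i @^-1` A i))%E.

Definition uniform01 (d : measure_display) (T : measurableType d)
    (R : realType) (P : probability T R) (Z : {RV P >-> R}) : Prop :=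
  forall A : set R, measurable A ->
    distribution P Z A = uniform_prob (@ltr01 R) A.

(* The [X i j] and the [Y i j] form one single independent family, indexed by
   the disjoint sum of two copies of ['I_n * 'I_m]. *)
Definition random_market (d : measure_display) (T : measurableType d)
    (R : realType) (P : probability T R) (n m : nat)
    (X Y : 'I_n -> 'I_m -> {RV P >-> R}) : Prop :=
  [/\ forall i j, uniform01 (X i j),
      forall i j, uniform01 (Y i j) &
      mutually_independent
        (fun s : ('I_n * 'I_m) + ('I_n * 'I_m) =>
           match s with inl p => X p.1 p.2 | inr p => Y p.1 p.2 end)].

(* For [z <= 0] the library conventions give the value [0] instead of
   [+oo]; this affects only an event of probability zero. *)
Definition utility (R : realType) (lam : R) (z : R) : R :=
  lam^-1 * ln (z^-1).

Section Matching.
Variables (R : realType) (n m : nat).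

(* [M i] is the worker matched to firm [i]; worker [j] is matched iff
   [j \in codom M], and its partner is then the unique [i'] with [M i' = j]. *)
Definition is_matching (M : {ffun 'I_n -> 'I_m}) : bool := injectiveb M.

Variables (f w : R -> R) (eps : R) (x y : 'I_n -> 'I_m -> R).

Definition blocks_matched (M : {ffun 'I_n -> 'I_m}) (i : 'I_n) (j : 'I_m) :=
  [exists i', [&& M i' == j,
                  f (x i j) > f (x i (M i)) + eps &
                  w (y i j) > w (y i' j) + eps]].

Definition blocks_unmatched (M : {ffun 'I_n -> 'I_m}) (i : 'I_n) (j : 'I_m) :=
  (j \notin codom M) && (f (x i j) > f (x i (M i)) + eps).

Definition eps_stable (M : {ffun 'I_n -> 'I_m}) : bool :=
  ~~ [exists i, exists j, blocks_matched M i j] &&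
  ~~ [exists i, exists j, blocks_unmatched M i j].

Definition nb_eps_stable : nat :=
  #|[set M : {ffun 'I_n -> 'I_m} | is_matching M && eps_stable M]|.

End Matching.

Definition expected_nb_eps_stable (d : measure_display) (T : measurableType d)
    (R : realType) (P : probability T R) (n m : nat) (lam eps : R)
    (X Y : 'I_n -> 'I_m -> {RV P >-> R}) : \bar R :=
  'E_P[fun t : T => (nb_eps_stable (utility lam) (utility lam) eps
                       (fun i j => X i j t) (fun i j => Y i j t))%:R].

(* Main.v *)
Require Import Defs.
From HB Require Import structures.
From mathcomp Require Import all_boot all_order all_algebra.
From mathcomp Require Import all_classical all_reals all_analysis.
From mathcomp Require Import measurable_realfun.
From mathcomp Require Import ring lra zify.
Set Implicit Arguments.
Unset Strict Implicit.
Unset Printing Implicit Defensive.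
Import Order.TTheory GRing.Theory Num.Theory.
Import numFieldNormedType.Exports.
Local Open Scope classical_set_scope.
Local Open Scope ring_scope.

(** Write [c = exp(- eps * lam)].  A firm [i] and a matched worker [j] block [M]
    when [X i j < c * X i (M i)] and [Y i j < c * Y i' j], where [M i' = j]; for an
    unmatched [j] the first inequality alone blocks.  Hence, given the values
    [x i = X i (M i)] and [y i = Y i (M i)], independence makes [M] eps-stable
    with probability
      [\prod_(i != i') (1 - c^2 * x i * y i') * \prod_i (1 - c * x i)^k],
    and the expected number of eps-stable matchings is [(n+k) ^_ n] times the
    integral of this product over the unit cube.

    Upper bound.  Replacing [c * x] and [c * y] by new variables costs a factor
    [c^(-2n)].  If the new [x i] have sum [s], integrating out the [y i] leaves
    [((1 - exp(-s)) / s)^n] up to a constant, and the last product is at most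
    [exp(- k * s)].  The simplex of sum [s] contributes [s^n / n!], so that what
    remains is [(n+k) ^_ n / n! * (1 - exp(-s))^n * exp(-s)^k]: a binomial
    probability, at most [1] for every [s] and every [k].  Therefore the
    expectation is at most [c^(-2n) = exp(2 * n * eps * lam)] times a polynomial in
    [n] ([grid_sum_le_poly]), which is polynomial when [eps * lam] is
    [O(ln n / n)].

    Lower bound.  The probability decreases with [c], so [c] may be raised to
    [n^(-A/n)] for a large constant [A].  Rescaling only the [x i],
    and bounding by [1] the factor [c] in front of the [y i], gains
    [c^(-n) = n^A].  The other factors lose a power of [n] that does not depend on
    [A] ([grid_sum_ge_poly]): take [s = ln(1 + n/k)], for which the binomial
    probability above is at its mode, and keep the [x] in the simplex of sum [s]
    whose coordinates are all [O(s * ln n / n)].  They fill at least half of the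
    simplex, and on them [1 - x i * y i'] may be replaced by
    [exp(- x i * y i')] at the price of a power of [n].

    Both bounds are carried out without multiple integrals.  The interval [0, 1]
    is cut into [N] cells; the product rule for independent variables sandwiches
    the probability of stability between two finite sums over the cells of the
    [x i] and [y i] ([expected_le_grid_sum], [expected_ge_grid_sum]).  In these
    sums the integrals over the [y i] are geometric sums, and the volume of a
    simplex is a binomial coefficient. *)

(** * Probability of finite families of boxes *)

Lemma measure_bigcup_finType (d : measure_display) (T : measurableType d)
    (R : realType) (mu : measure T R) (I : finType) (F : I -> set T) :
  (forall i, measurable (F i)) -> trivIset setT F ->
  mu (\bigcup_i F i) = (\sum_i mu (F i))%E.
Proof.
move=> mF tF; rewrite measure_fin_bigcup//; last exact: finite_finset.
by rewrite (@fsbigE _ _ _ _ _ (index_enum I)) ?index_enum_uniq//;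
  [apply: eq_bigl => i; rewrite in_setT | move=> i _; rewrite mem_index_enum].
Qed.

Lemma uniform01_itv (d : measure_display) (T : measurableType d)
    (R : realType) (P : probability T R) (Z : {RV P >-> R}) (a b : R) :
  uniform01 Z -> 0 <= a -> a <= b -> b <= 1 ->
  P (Z @^-1` `]a, b]) = (b - a)%:E.
Proof.
move=> uZ a0 ab b1.
have := uZ `]a, b]%classic (measurable_itv _).
rewrite /distribution /pushforward /= => ->.
rewrite /uniform_prob integral_uniform_pdf setIidl; last first.
  move=> x /=; rewrite !in_itv/= => /andP[ax xb].
  by rewrite (le_trans a0 (ltW ax)) (le_trans xb b1).
rewrite (eq_integral (cst 1%E)); last first.
  move=> x; rewrite inE/= in_itv/= => /andP[ax xb].
  by rewrite /uniform_pdf (le_trans a0 (ltW ax)) (le_trans xb b1)/= subr0 invr1.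
rewrite integral_cst//= mul1e lebesgue_measure_itv/= lte_fin.
by case: ifPn => [_|]; [rewrite EFinB | rewrite -leNgt => ba;
  rewrite (le_anti (introT andP (conj ab ba))) subrr].
Qed.

(** Blocking is a conjunction of a condition on [X] and one on [Y], so the event
    that a pair does not block is not a box but a disjoint union of two: the [X]
    condition fails, or it holds and the [Y] condition fails.  Expanding over the
    choice of a box for each pair gives a disjoint union of boxes, and
    distributivity folds the sum of their probabilities into a product. *)
Lemma indep_rect_unions (d : measure_display) (T : measurableType d)
    (R : realType) (P : probability T R) (K : finType)
    (X Y : K -> {RV P >-> R})
    (indep : mutually_independent
       (fun s : K + K => match s with inl p => X p | inr p => Y p end))
    (A B : bool -> K -> set R) (pA pB : bool -> K -> R) :
  (forall b p, measurable (A b p)) -> (forall b p, measurable (B b p)) ->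
  (forall p, A true p `&` A false p = set0) ->
  (forall b p, P (X p @^-1` A b p) = (pA b p)%:E) ->
  (forall b p, P (Y p @^-1` B b p) = (pB b p)%:E) ->
  P [set t | forall p, exists b, A b p (X p t) /\ B b p (Y p t)]
  = (\prod_p \sum_(b : bool) (pA b p * pB b p))%:E.
Proof.
move=> mA mB A0 hA hB.
pose Z (s : K + K) := match s with inl p => X p | inr p => Y p end.
pose C (g : {ffun K -> bool}) (s : K + K) :=
  match s with inl p => A (g p) p | inr p => B (g p) p end.
have mC g s : measurable (C g s) by case: s => p /=.
pose F (g : {ffun K -> bool}) := \bigcap_(s in [set` [set: K + K]%SET]) (Z s @^-1` C g s).
have PF g : P (F g) = (\prod_p (pA (g p) p * pB (g p) p))%:E.
  rewrite /F (indep _ _ (mC g)).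
  have -> : (\prod_(i in [set: K + K]%SET) P (Z i @^-1` C g i))%E =
     (\prod_(i : K + K) (match i with inl p => pA (g p) p | inr p =>
       pB (g p) p end)%:E)%E.
    by apply: eq_big => [i|[p|p] _]; rewrite ?finset.in_setT //= ?hA ?hB.
  by rewrite prodEFin big_sumType/= big_split.
have -> : [set t | forall p, exists b, A b p (X p t) /\ B b p (Y p t)] = \bigcup_g F g.
  apply/seteqP; split=> t /=.
    move=> /choice[g hg]; exists [ffun p => g p] => // -[p|p] _ /=; rewrite ffunE;
    by case: (hg p).
  move=> [g _ hg] p; exists (g p); split.
    by have := hg (inl p) (finset.in_setT _).
  by have := hg (inr p) (finset.in_setT _).
rewrite measure_bigcup_finType//; first last.
- apply/trivIsetP => g g' _ _ gg'; apply/seteqP; split=> // t [hg hg'].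
  have [p ] : exists p, g p != g' p.
    apply/existsP; apply: contraNT gg'; rewrite negb_exists => /forallP h.
    by apply/eqP/ffunP => p; have := h p; rewrite negbK => /eqP.
  have := hg (inl p) (finset.in_setT _); have := hg' (inl p) (finset.in_setT _);
    rewrite /=.
  have hp := A0 p; case: (g p) (g' p) => [] [] //= h1 h2 _.
    by have : (A true p `&` A false p) (X p t) by []; rewrite hp.
  by have : (A true p `&` A false p) (X p t) by []; rewrite hp.
- move=> g; apply: fin_bigcap_measurable; first exact: finite_finset.
  move=> s _; rewrite -[X in measurable X]setTI; exact: measurable_funPT.
rewrite (eq_bigr _ (fun g _ => PF g)) sumEFin; congr (_%:E).
by rewrite (bigA_distr_bigA (fun p b => pA b p * pB b p)).
Qed.

(** * The stability region of a matching *)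

(** With [u i = c * x i] and [v i = c * y i], this is the conditional
    probability that a given matching is eps-stable. *)
Definition stable_weight (R : realType) (n k : nat) (u v : 'I_n -> R) : R :=
  (\prod_i \prod_(i' | i' != i) (1 - u i * v i')) * \prod_i (1 - u i) ^+ k.

(** Half-open on the left: the cells then partition the interval (0, 1], which
    avoids the value [0] where the logarithm is a convention. *)
Definition cell (R : realType) (N a : nat) : set R :=
  `]a%:R / N%:R, a.+1%:R / N%:R]%classic.

(** The boxes allowed for the variables of the pair [p = (i, j)]: on the graph
    of [M] the two variables lie in prescribed cells; elsewhere [c = true] says
    that the firm does not gain by more than the threshold [u i], and [c = false]
    that it does while the worker, necessarily matched, does not. *)
Definition regionX (R : realType) (n m N : nat) (M : {ffun 'I_n -> 'I_m})
    (a : 'I_n -> nat) (u : 'I_n -> R) (c : bool) (p : 'I_n * 'I_m) : set R :=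
  if p.2 == M p.1 then (if c then cell N (a p.1) else set0)
  else if c then `]u p.1, 1]%classic else `]0, u p.1]%classic.

Definition regionY (R : realType) (n m N : nat) (M : {ffun 'I_n -> 'I_m})
    (b : 'I_n -> nat) (v : 'I_n -> R) (c : bool) (p : 'I_n * 'I_m) : set R :=
  if p.2 == M p.1 then cell N (b p.1)
  else if c then `]0, 1]%classic
  else if [pick i | M i == p.2] is Some i then `]v i, 1]%classic else set0.

Definition stable_region (R : realType) (n m N : nat) (M : {ffun 'I_n -> 'I_m})
    (a b : 'I_n -> nat) (u v : 'I_n -> R) (x y : 'I_n -> 'I_m -> R) : Prop :=
  forall p : 'I_n * 'I_m, exists c,
    regionX N M a u c p (x p.1 p.2) /\ regionY N M b v c p (y p.1 p.2).

Lemma measurable_regionX (R : realType) (n m N : nat) (M : {ffun 'I_n -> 'I_m})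
  a u c p : measurable (@regionX R n m N M a u c p).
Proof. by rewrite /regionX; case: ifP => _; case: c => //; exact: measurable_itv. Qed.

Lemma measurable_regionY (R : realType) (n m N : nat) (M : {ffun 'I_n -> 'I_m})
  b v c p : measurable (@regionY R n m N M b v c p).
Proof.
rewrite /regionY; case: ifP => _; first exact: measurable_itv.
by case: c; [|case: pickP => [i _|_]] => //; exact: measurable_itv.
Qed.

Lemma pick_injective (n m : nat) (M : {ffun 'I_n -> 'I_m}) i :
  injective M -> [pick i' | M i' == M i] = Some i.
Proof. by move=> injM; case: pickP => [i' /eqP/injM->|/(_ i)/eqP]. Qed.

(** The workers other than [M i] are the [n - 1] partners of the other firms,
    each giving [1 - w + w * (1 - v i') = 1 - w * v i'], and [k] unmatched ones,
    each giving [1 - w]. *)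
Lemma prod_row_stable (R : realType) (n k : nat) (M : {ffun 'I_n -> 'I_(n + k)})
   (g0 : R) (w : R) (v : 'I_n -> R) i : injective M ->
  \prod_j (if j == M i then g0 else
     1 - w + w * (if [pick i' | M i' == j] is Some i' then 1 - v i' else 0))
  = g0 * (\prod_(i' | i' != i) (1 - w * v i')) * (1 - w) ^+ k.
Proof.
move=> injM.
rewrite (bigID (mem (M @: [set: 'I_n])%SET)) /=; congr (_ * _).
  rewrite big_imset/=; last by move=> x y _ _; exact: injM.
  rewrite (bigD1 i) ?finset.in_setT //=.
  rewrite eqxx; congr (_ * _).
  apply: eq_big => [i'|i' /andP[_ i'i]]; first by rewrite finset.in_setT.
  by rewrite (inj_eq injM) (negPf i'i) pick_injective//; ring.
rewrite (eq_bigr (fun=> 1 - w)).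
  rewrite prodr_const; congr (_ ^+ _).
  rewrite -[LHS]/#|[predC (M @: [set: 'I_n])%SET]|.
  have := cardC (mem (M @: [set: 'I_n])%SET).
  by rewrite card_imset// cardsT !card_ord => /addnI.
move=> j jM; case: eqP => [jE|_].
  by move: jM; rewrite jE imset_f ?finset.in_setT.
case: pickP => [i' /eqP iE|_]; last by rewrite mulr0 addr0.
by move: jM; rewrite -iE imset_f ?finset.in_setT.
Qed.

Lemma cell_sub01 (R : realType) (N a : nat) : (a < N)%N ->
  [/\ 0 <= a%:R / N%:R :> R, a%:R / N%:R <= a.+1%:R / N%:R :> R &
      a.+1%:R / N%:R <= 1 :> R].
Proof.
move=> aN; have N0 : 0 < N%:R :> R by rewrite ltr0n (leq_ltn_trans _ aN).
rewrite divr_ge0 ?ler0n//; split=> //.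
  by rewrite ler_pM2r ?invr_gt0// ler_nat.
by rewrite ler_pdivrMr// mul1r ler_nat.
Qed.

Lemma prob_stable_region (R : realType) (d : measure_display)
  (T : measurableType d) (P : probability T R) (n k N : nat)
  (X Y : 'I_n -> 'I_(n + k) -> {RV P >-> R}) (M : {ffun 'I_n -> 'I_(n + k)})
  (a b : 'I_n -> nat) (u v : 'I_n -> R) :
  random_market X Y -> injective M ->
  (forall i, a i < N)%N -> (forall i, b i < N)%N ->
  (forall i, 0 <= u i <= 1) -> (forall i, 0 <= v i <= 1) ->
  P [set t | stable_region N M a b u v (fun i j => X i j t) (fun i j => Y i j t)]
  = (N%:R ^- (2 * n) * stable_weight k u v)%:E.
Proof.
move=> [uX uY indep] injM aN bN u01 v01.
pose pA (c : bool) (p : 'I_n * 'I_(n + k)) : R :=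
  if p.2 == M p.1 then (if c then N%:R^-1 else 0)
  else if c then 1 - u p.1 else u p.1.
pose pB (c : bool) (p : 'I_n * 'I_(n + k)) : R :=
  if p.2 == M p.1 then N%:R^-1
  else if c then 1 else if [pick i | M i == p.2] is Some i then 1 - v i else 0.
have cellE (Z : {RV P >-> R}) a' : uniform01 Z -> (a' < N)%N ->
  P (Z @^-1` @cell R N a') = N%:R^-1%:E.
  move=> uZ aN'; have [? ? ?] := cell_sub01 R aN'.
  by rewrite uniform01_itv// -mulrBl -natrB// subSnn mul1r.
rewrite (@indep_rect_unions _ _ _ _ _ _ _ indep (regionX N M a u) (regionY N M b v)
  pA pB).
- congr (_%:E); rewrite -(pair_bigA _ (fun i j =>
  \sum_(c : bool) pA c (i, j) * pB c (i, j))) /=.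
  rewrite (eq_bigr (fun i => N%:R ^- 2 * (\prod_(i' | i' != i) (1 - u i * v i'))
    * (1 - u i) ^+ k)).
    rewrite !big_split /= prodr_const card_ord exprVn -exprM -mulrA.
    by [].
  move=> i _; rewrite -(prod_row_stable _ _ _ _ injM); apply: eq_bigr => j _.
  rewrite big_bool /pA /pB /= -exprVn; case: eqP => _; last by rewrite mulr1.
  by rewrite mul0r addr0 expr2.
- move=> *; exact: measurable_regionX.
- move=> *; exact: measurable_regionY.
- move=> p; rewrite /regionX; case: ifP => _; first by rewrite setI0.
  apply/seteqP; split => // x /=; rewrite !in_itv /= => -[/andP[h _] /andP[_ h']].
  by move: (lt_le_trans h h'); rewrite ltxx.
- move=> c p; have /andP[u0 u1] := u01 p.1; rewrite /regionX /pA; case: ifP => _; case: c.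
  + exact: cellE.
  + by rewrite preimage_set0 measure0.
  + by rewrite uniform01_itv.
  + by rewrite uniform01_itv// subr0.
- move=> c p; rewrite /regionY /pB; case: ifP => _; first exact: cellE.
  case: c; first by rewrite uniform01_itv// subr0.
  case: pickP => [i _|_]; last by rewrite preimage_set0 measure0.
  by have /andP[v0 v1] := v01 i; rewrite uniform01_itv.
Qed.

(** At [z <= 0] both sides vanish, since the logarithm of a nonpositive number
    is [0]. *)
Lemma utilityE (R : realType) (lam z : R) : utility lam z = - (lam^-1 * ln z).
Proof.
rewrite /utility; have [z0|z0] := ltP 0 z; first by rewrite lnV ?posrE// mulrN.
by rewrite (ln0 z0) ln0 ?invr_le0// mulr0 oppr0.
Qed.

(** An additive gain of [eps] in utility is a multiplicative gain in the
    underlying variable. *)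
Lemma utility_gt (R : realType) (lam eps x x' : R) :
  0 < lam -> 0 < x -> 0 < x' ->
  (utility lam x > utility lam x' + eps) = (x < expR (- (eps * lam)) * x').
Proof.
move=> l0 x0 x'0; rewrite !utilityE ltrNr opprD opprK.
rewrite -(ltr_pM2l l0) mulrDr !mulrA mulrN !mulfV ?gt_eqF// !mul1r (mulrC lam).
rewrite -[in RHS]ltr_ln ?posrE// ?mulr_gt0 ?expR_gt0//.
by rewrite lnM ?posrE ?expR_gt0// expRK addrC.
Qed.

(** In a cell the variable exceeds the left end, so the thresholds taken at left
    ends are below the true ones: a stable matching stays stable for them. *)
Lemma eps_stable_stable_region (R : realType) (n m N : nat) (lam eps c : R)
  (M : {ffun 'I_n -> 'I_m}) (a b : 'I_n -> nat) (x y : 'I_n -> 'I_m -> R) :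
  0 < lam -> c = expR (- (eps * lam)) -> injective M ->
  (forall i j, x i j \in `]0, 1]) -> (forall i j, y i j \in `]0, 1]) ->
  (forall i, cell N (a i) (x i (M i))) -> (forall i, cell N (b i) (y i (M i))) ->
  eps_stable (utility lam) (utility lam) eps x y M ->
  stable_region N M a b (fun i => c * (a i)%:R / N%:R) (fun i => c * (b i)%:R / N%:R) x y.
Proof.
move=> l0 cE injM x01 y01 xa yb /andP[/existsPn stM /existsPn stU] [i j] /=.
have c0 : 0 < c by rewrite cE expR_gt0.
rewrite /regionX /regionY /=; case: eqP => [->|/eqP jM]; first by exists true.
have uX : utility lam (x i j) > utility lam (x i (M i)) + eps = (x i j < c * x i (M i)).
  by rewrite utility_gt ?cE//; have := x01 i j; have := x01 i (M i);
    rewrite !in_itv/= => /andP[? _] /andP[].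
have := x01 i j; have := y01 i j; rewrite !in_itv/= => /andP[y0 y1] /andP[x0 x1].
have [ux|xu] := ltP (c * (a i)%:R / N%:R) (x i j).
  by exists true; rewrite /= !in_itv/= ux x1 y0 y1.
exists false; split; first by rewrite /= in_itv/= x0 xu.
have xc : x i j < c * x i (M i).
  apply: le_lt_trans xu _; rewrite -mulrA ltr_pM2l//.
  by have := xa i; rewrite /cell/= in_itv/= => /andP[].
case: pickP => [i' /eqP iE|jN] /=; last first.
  move: (stU i) => /existsPn/(_ j); rewrite /blocks_unmatched uX xc andbT negbK.
  by move=> /codomP[i' jE]; have := jN i'; rewrite jE eqxx.
rewrite in_itv/= y1 andbT.
move: (stM i) => /existsPn/(_ j)/existsPn/(_ i'); rewrite iE eqxx uX xc /=.
rewrite utility_gt//; last first.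
  by have := y01 i' j; rewrite in_itv/= => /andP[].
rewrite -cE -leNgt; apply: lt_le_trans; rewrite -mulrA ltr_pM2l//.
by have := yb i'; rewrite /cell/= in_itv/= iE => /andP[].
Qed.

(** Right ends overestimate the thresholds, and so does a constant [c] larger
    than the true one; the latter makes the lower bound monotone in
    [eps * lam]. *)
Lemma stable_region_eps_stable (R : realType) (n m N : nat) (lam eps c : R)
  (M : {ffun 'I_n -> 'I_m}) (a b : 'I_n -> nat) (x y : 'I_n -> 'I_m -> R) :
  0 < lam -> 0 < eps -> expR (- (eps * lam)) <= c -> injective M ->
  stable_region N M a b (fun i => c * (a i).+1%:R / N%:R)
    (fun i => c * (b i).+1%:R / N%:R) x y ->
  eps_stable (utility lam) (utility lam) eps x y M.
Proof.
move=> l0 e0 cE injM st.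
pose c' := expR (- (eps * lam)).
have c'0 : 0 < c' by rewrite expR_gt0.
have xa i : cell N (a i) (x i (M i)).
  by have [[]] := st (i, M i); rewrite /regionX /= eqxx => -[].
have yb i : cell N (b i) (y i (M i)).
  by have [[]] := st (i, M i); rewrite /regionY /= eqxx => -[].
have cell_gt0 a' (z : R) : cell N a' z -> 0 < z.
  rewrite /cell/= in_itv/= => /andP[+ _]; apply: le_lt_trans.
  by rewrite divr_ge0 ?ler0n.
have cell_c a' (z z' : R) : cell N a' z -> c * a'.+1%:R / N%:R < z' -> c' * z <= z'.
  move=> az /ltW; apply: le_trans.
  apply: (@le_trans _ _ (c * z)); first by rewrite ler_pM2r ?cE// (cell_gt0 _ _ az).
  rewrite -mulrA ler_pM2l ?(lt_le_trans c'0)//.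
  by move: az; rewrite /cell/= in_itv/= => /andP[].
have key i j : j != M i -> (c' * x i (M i) <= x i j /\ 0 < x i j) \/
   (0 < x i j /\ exists i', M i' = j /\ c' * y i' j <= y i j /\ 0 < y i j).
  move=> jM; have /= := st (i, j); rewrite /regionX /regionY /= (negPf jM).
  case=> -[] /= []; rewrite !in_itv/= => /andP[h1 h2] yj.
    left; have h := cell_c _ _ _ (xa i) h1; split => //.
    by apply: lt_le_trans h; rewrite mulr_gt0// (cell_gt0 _ _ (xa i)).
  right; split=> //; move: yj; case: pickP => // i' /eqP iE /=.
  rewrite in_itv/= => /andP[h _]; exists i'; split=> //.
  have := yb i'; rewrite iE => ybi.
  have h' := cell_c _ _ _ ybi h; split => //.
  by apply: lt_le_trans h'; rewrite mulr_gt0// (cell_gt0 _ _ ybi).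
have nself (z : R) : (z > z + eps) = false.
  by apply/negbTE; rewrite -leNgt lerDl ltW.
apply/andP; split; apply/existsPn => i; apply/existsPn => j.
  apply/existsPn => i'; apply/negP => /and3P[/eqP iE].
  have [->|jM] := eqVneq j (M i); first by rewrite nself.
  have [[h0 h1]|[x0 [i'' [iE'' [h h1]]]]] := key i j jM.
    by rewrite utility_gt ?(cell_gt0 _ _ (xa i))// ltNge h0.
  move=> _; have <- : i'' = i' by apply: injM; rewrite iE''.
  rewrite utility_gt//; first by rewrite ltNge h.
  by rewrite -iE''; exact: cell_gt0 (yb i'').
apply/negP => /andP[jN].
have jM : j != M i by apply: contraNneq jN => ->; exact: codom_f.
have [[h0 h1]|[x0 [i' [iE _]]]] := key i j jM.
  by rewrite utility_gt ?(cell_gt0 _ _ (xa i))// ltNge h0.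
by move: jN; rewrite -iE codom_f.
Qed.

(** * Expected number of stable matchings as a grid sum *)

Lemma measurable_exists (d : measure_display) (T : measurableType d)
   (I : finType) (Q : I -> T -> bool) :
  (forall i, measurable [set t | Q i t]) -> measurable [set t | [exists i, Q i t]].
Proof.
move=> mQ; have -> : [set t | [exists i, Q i t]] = \bigcup_i [set t | Q i t].
  by apply/seteqP; split=> t /=; [move=> /existsP[i]; exists i | move=> [i _ h];
    apply/existsP; exists i].
by apply: fin_bigcup_measurable => //; exact: finite_finset.
Qed.

Lemma measurable_andb (d : measure_display) (T : measurableType d)
   (Q Q' : T -> bool) :
  measurable [set t | Q t] -> measurable [set t | Q' t] ->
  measurable [set t | Q t && Q' t].
Proof.
move=> mQ mQ'; have -> : [set t | Q t && Q' t] = [set t | Q t] `&` [set t | Q' t].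
  by apply/seteqP; split=> t /= /andP.
exact: measurableI.
Qed.

Lemma measurable_negb (d : measure_display) (T : measurableType d)
   (Q : T -> bool) :
  measurable [set t | Q t] -> measurable [set t | ~~ Q t].
Proof.
move=> mQ; have -> : [set t | ~~ Q t] = ~` [set t | Q t].
  by apply/seteqP; split=> t /= /negP.
exact: measurableC.
Qed.

Lemma measurable_constb (d : measure_display) (T : measurableType d) (q : bool) :
  measurable [set t : T | q].
Proof.
case: q; first by rewrite (_ : [set _ | _] = setT)//; apply/seteqP; split.
by rewrite (_ : [set _ | _] = set0)//; apply/seteqP; split.
Qed.

Lemma measurable_utility (R : realType) (lam : R) : measurable_fun setT (utility lam).
Proof.
rewrite (_ : utility lam = (fun z => - (lam^-1 * ln z))); last first.
  by apply/funext => z; rewrite utilityE.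
apply: measurableT_comp => //; apply: measurable_funM => //; exact: measurable_ln.
Qed.

Lemma measurable_eps_stable (R : realType) (d : measure_display)
  (T : measurableType d) (P : probability T R) (n m : nat) (lam eps : R)
  (X Y : 'I_n -> 'I_m -> {RV P >-> R}) (M : {ffun 'I_n -> 'I_m}) :
  measurable [set t | eps_stable (utility lam) (utility lam) eps
    (fun i j => X i j t) (fun i j => Y i j t) M].
Proof.
have mlt (Z Z' : {RV P >-> R}) :
    measurable [set t | utility lam (Z t) > utility lam (Z' t) + eps].
  have mU (W : {RV P >-> R}) : measurable_fun setT (fun t => utility lam (W t)).
    by apply: measurableT_comp; [exact: measurable_utility|exact: measurable_funPT].
  rewrite -[X in measurable X]setTI.
  have mD : measurable_fun setT (fun t => utility lam (Z' t) + eps).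
    by apply: measurable_funD.
  have h := measurable_fun_ltr mD (mU Z) measurableT (Y := [set true]) I.
  exact: h.
rewrite /eps_stable; apply: measurable_andb; apply: measurable_negb;
  apply: measurable_exists => i; apply: measurable_exists => j.
  apply: measurable_exists => i'; apply: measurable_andb; first exact: measurable_constb.
  by apply: measurable_andb; exact: mlt.
by apply: measurable_andb; [exact: measurable_constb | exact: mlt].
Qed.

Lemma expected_nb_eps_stableE (R : realType) (d : measure_display)
  (T : measurableType d) (P : probability T R) (n m : nat) (lam eps : R)
  (X Y : 'I_n -> 'I_m -> {RV P >-> R}) :
  expected_nb_eps_stable lam eps X Y =
  (\sum_(M : {ffun 'I_n -> 'I_m} | injectiveb M)
    P [set t | eps_stable (utility lam) (utility lam) eps
         (fun i j => X i j t) (fun i j => Y i j t) M])%E.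
Proof.
pose S M := [set t | eps_stable (utility lam) (utility lam) eps
         (fun i j => X i j t) (fun i j => Y i j t) M].
have mS M : measurable (S M) by exact: measurable_eps_stable.
rewrite /expected_nb_eps_stable unlock.
rewrite [RHS](_ : _ = \sum_(M <- [seq M : {ffun 'I_n ->
  'I_m} <- index_enum _ | injectiveb M])
   \int[P]_t (\1_(S M) t)%:E)%E; last first.
  by rewrite big_filter; apply: eq_bigr => M _; rewrite integral_indic// setIT.
rewrite -ge0_integral_sum//; last first.
- by move=> M; apply/measurable_EFinP; exact: measurable_indic.
apply: eq_integral => t _; rewrite sumEFin big_filter; congr (_%:E).
rewrite /nb_eps_stable -sum1_card natr_sum big_mkcond [RHS]big_mkcond/=.
apply: eq_bigr => M _; rewrite indicE (_ : (t \in S M) = eps_stable (utility lam)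
  (utility lam) eps
         (fun i j => X i j t) (fun i j => Y i j t) M); last first.
  by apply/idP/idP; rewrite inE.
rewrite [in LHS]unfold_in asboolb /is_matching.
by case: injectiveb => //=; case: ifP.
Qed.

(** The sum over all cells of the [2 * n] variables on the graph of a matching;
    [u a] is the threshold attached to the cell of index [a]. *)
Definition grid_sum (R : realType) (n k N : nat) (u : nat -> R) : R :=
  \sum_(ab : {ffun 'I_n -> 'I_N} * {ffun 'I_n -> 'I_N})
    N%:R ^- (2 * n) *
    stable_weight k (fun i => u (ab.1 i)) (fun i => u (ab.2 i)).

Lemma cell_inj (R : realType) (N a a' : nat) (z : R) :
  cell N a z -> cell N a' z -> a = a'.
Proof.
rewrite /cell/= !in_itv/= => /andP[h1 h2] /andP[h1' h2'].
have [N0|N0] := posnP N.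
  by move: (lt_le_trans h1 h2); rewrite N0 invr0 !mulr0 ltxx.
have N0' : 0 < N%:R :> R by rewrite ltr0n.
have := lt_le_trans h1 h2'; have := lt_le_trans h1' h2.
rewrite !ltr_pM2r ?invr_gt0// !ltr_nat !ltnS => ? ?.
by apply/eqP; rewrite eqn_leq; apply/andP.
Qed.

Lemma cell_cover (R : realType) (N : nat) (z : R) :
  (0 < N)%N -> z \in `]0, 1] -> exists a : 'I_N, cell N a z.
Proof.
move=> N0; rewrite in_itv/= => /andP[z0 z1].
have N0' : 0 < N%:R :> R by rewrite ltr0n.
have hP : exists a, z <= a.+1%:R / N%:R.
  by exists N.-1; rewrite prednK// divff ?gt_eqF.
case: (ex_minnP hP) => a ha amin.
have aN : (a < N)%N.
  by rewrite -(prednK N0) ltnS amin// prednK// divff ?gt_eqF.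
exists (Ordinal aN); rewrite /cell/= in_itv/= ha andbT.
case: a ha amin aN => [|a] ha amin aN; first by rewrite mul0r.
by rewrite ltNge; apply/negP => /amin; rewrite ltnn.
Qed.

Lemma measurable_stable_region (R : realType) (d : measure_display)
  (T : measurableType d) (P : probability T R) (n m N : nat)
  (X Y : 'I_n -> 'I_m -> {RV P >-> R}) (M : {ffun 'I_n -> 'I_m})
  (a b : 'I_n -> nat) (u v : 'I_n -> R) :
  measurable [set t | stable_region N M a b u v
    (fun i j => X i j t) (fun i j => Y i j t)].
Proof.
rewrite (_ : [set t | _] = \bigcap_(p : 'I_n * 'I_m) \bigcup_(c : bool)
  ((X p.1 p.2 @^-1` regionX N M a u c p) `&` (Y p.1 p.2 @^-1` regionY N M b v c p))).
  apply: fin_bigcap_measurable; first exact: finite_finset.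
  move=> p _; apply: fin_bigcup_measurable; first exact: finite_finset.
  move=> c _; apply: measurableI; rewrite -[X in measurable X]setTI.
    by apply: measurable_funPT => //; exact: measurable_regionX.
  by apply: measurable_funPT => //; exact: measurable_regionY.
apply/seteqP; split => t /= h p; first by move=> _; have [c hc] := h p; exists c.
by have [c _ hc] := h p I; exists c.
Qed.

Lemma stable_region_cells (R : realType) (n m N : nat) (M : {ffun 'I_n -> 'I_m})
  (a b : 'I_n -> nat) (u v : 'I_n -> R) (x y : 'I_n -> 'I_m -> R) i :
  stable_region N M a b u v x y ->
  cell N (a i) (x i (M i)) /\ cell N (b i) (y i (M i)).
Proof.
by move=> st; have [[]] := st (i, M i); rewrite /regionX /regionY /= eqxx => -[].
Qed.

(** The regions attached to distinct cells are disjoint because a point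
    determines its cells. *)
Lemma prob_bigcup_stable_region (R : realType) (d : measure_display)
  (T : measurableType d) (P : probability T R) (n k N : nat)
  (X Y : 'I_n -> 'I_(n + k) -> {RV P >-> R}) (M : {ffun 'I_n -> 'I_(n + k)})
  (u : nat -> R) :
  random_market X Y -> injective M ->
  (forall a, (a < N)%N -> 0 <= u a <= 1) ->
  P (\bigcup_(ab : {ffun 'I_n -> 'I_N} * {ffun 'I_n -> 'I_N})
    [set t | stable_region N M (fun i => ab.1 i) (fun i => ab.2 i)
       (fun i => u (ab.1 i)) (fun i => u (ab.2 i))
       (fun i j => X i j t) (fun i j => Y i j t)])
  = (grid_sum n k N u)%:E.
Proof.
move=> rm injM u01; rewrite measure_bigcup_finType.
- rewrite -sumEFin; apply: eq_bigr => ab _.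
  by apply: (prob_stable_region rm injM) => i; rewrite ?ltn_ord ?u01.
- by move=> ab; exact: measurable_stable_region.
- apply/trivIsetP => -[a b] [a' b'] _ _ neq; apply/seteqP; split => // t [/= h h'].
  have aa' : a = a'.
    apply/ffunP => i; apply: val_inj.
    have [+ _] := stable_region_cells i h; have [+ _] := stable_region_cells i h'.
    by move=> c' c; exact: cell_inj c c'.
  have bb' : b = b'.
    apply/ffunP => i; apply: val_inj.
    have [_ +] := stable_region_cells i h; have [_ +] := stable_region_cells i h'.
    by move=> c' c; exact: cell_inj c c'.
  by move: neq; rewrite aa' bb' eqxx.
Qed.

Lemma prob_eps_stable_ge (R : realType) (d : measure_display)
  (T : measurableType d) (P : probability T R) (n k N : nat) (lam eps c : R)
  (X Y : 'I_n -> 'I_(n + k) -> {RV P >-> R}) (M : {ffun 'I_n -> 'I_(n + k)}) :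
  random_market X Y -> injective M -> 0 < lam -> 0 < eps ->
  expR (- (eps * lam)) <= c -> c <= 1 ->
  ((grid_sum n k N (fun a => c * a.+1%:R / N%:R))%:E <=
   P [set t | eps_stable (utility lam) (utility lam) eps
         (fun i j => X i j t) (fun i j => Y i j t) M])%E.
Proof.
move=> rm injM l0 e0 ce c1.
have c0 : 0 <= c by apply: le_trans ce; exact: expR_ge0.
rewrite -(prob_bigcup_stable_region rm injM).
  apply: le_measure; rewrite ?inE.
  - by apply: fin_bigcup_measurable; [exact: finite_finset|move=> *;
    exact: measurable_stable_region].
  - exact: measurable_eps_stable.
  - by move=> t [ab _ /= h]; exact: stable_region_eps_stable h.
move=> a aN; have [h1 h2 h3] := cell_sub01 R aN.
rewrite -mulrA mulr_ge0 ?divr_ge0//=.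
by apply: le_trans h3; rewrite ler_piMl// divr_ge0.
Qed.

(** All variables lie in (0, 1] almost surely, and there the stable event is
    covered by the regions of the various cells. *)
Lemma prob_eps_stable_le (R : realType) (d : measure_display)
  (T : measurableType d) (P : probability T R) (n k N : nat) (lam eps c : R)
  (X Y : 'I_n -> 'I_(n + k) -> {RV P >-> R}) (M : {ffun 'I_n -> 'I_(n + k)}) :
  random_market X Y -> injective M -> (0 < N)%N -> 0 < lam -> 0 < eps ->
  c = expR (- (eps * lam)) ->
  (P [set t | eps_stable (utility lam) (utility lam) eps
         (fun i j => X i j t) (fun i j => Y i j t) M] <=
   (grid_sum n k N (fun a => c * a%:R / N%:R))%:E)%E.
Proof.
move=> rm injM N0 l0 e0 cE.
have c0 : 0 <= c by rewrite cE expR_ge0.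
have c1 : c <= 1 by rewrite cE -[leRHS]expR0 ler_expR oppr_le0 mulr_ge0 ?ltW.
pose Good := [set t | forall p : 'I_n * 'I_(n + k), exists b : bool,
  (if b then `]0, 1]%classic else set0) (X p.1 p.2 t) /\
  (if b then `]0, 1]%classic else set0) (Y p.1 p.2 t)].
have [uX uY indep] := rm.
have PG : P Good = 1%E.
  rewrite /Good (@indep_rect_unions _ _ _ _ _ _ _ indep
    (fun b _ => if b then `]0, 1]%classic else set0)
    (fun b _ => if b then `]0, 1]%classic else set0)
    (fun b _ => b%:R) (fun b _ => b%:R)).
  - by rewrite big1// => p _; rewrite big_bool /= mulr1 mulr0 addr0.
  - by case=> // _; exact: measurable_itv.
  - by case=> // _; exact: measurable_itv.
  - by move=> p; rewrite setI0.
  - by case=> p; rewrite ?preimage_set0 ?measure0// uniform01_itv// subr0.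
  - by case=> p; rewrite ?preimage_set0 ?measure0// uniform01_itv// subr0.
set S := [set t | eps_stable _ _ _ _ _ M].
have mS : measurable S by exact: measurable_eps_stable.
have mG : measurable Good.
  rewrite (_ : Good = \bigcap_(p : 'I_n * 'I_(n + k)) \bigcup_(b : bool)
    ((X p.1 p.2 @^-1` (if b then `]0, 1]%classic else set0)) `&`
     (Y p.1 p.2 @^-1` (if b then `]0, 1]%classic else set0)))).
    apply: fin_bigcap_measurable; first exact: finite_finset.
    move=> p _; apply: fin_bigcup_measurable; first exact: finite_finset.
    move=> b _; apply: measurableI; rewrite -[X in measurable X]setTI;
    by apply: measurable_funPT => //; case: b => //; exact: measurable_itv.
  apply/seteqP; split => t /= h p; first by move=> _; have [b hb] := h p; exists b.
  by have [b _ hb] := h p I; exists b.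
have PCG : P (~` Good) = 0%E by rewrite probability_setC// PG subee.
have -> : P S = P (S `&` Good).
  apply/eqP; rewrite eq_le; apply/andP; split; last first.
    by apply: le_measure; rewrite ?inE//; exact: measurableI.
  rewrite -[S in leLHS](setIT S) -(setUv Good) setIUr.
  apply: le_trans (measureU2 _ _ _) _; [exact: measurableI|by apply: measurableI => //;
    exact: measurableC|].
  rewrite -[leRHS]adde0 leeD2l// -PCG; apply: le_measure; rewrite ?inE.
  - by apply: measurableI => //; exact: measurableC.
  - exact: measurableC.
  - by move=> t [].
rewrite -(prob_bigcup_stable_region rm injM).
  apply: le_measure; rewrite ?inE.
  - exact: measurableI.
  - by apply: fin_bigcup_measurable; [exact: finite_finset|move=> *;
    exact: measurable_stable_region].
  - move=> t [St Gt].
    have x01 i j : X i j t \in `]0, 1].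
      by have [[]] := Gt (i, j) => // -[].
    have y01 i j : Y i j t \in `]0, 1].
      by have [[]] := Gt (i, j) => // -[].
    have /choice[a ha] i := cell_cover N0 (x01 i (M i)).
    have /choice[b hb] i := cell_cover N0 (y01 i (M i)).
    exists (finfun a, finfun b) => //=.
    apply: (eps_stable_stable_region l0 cE injM x01 y01) => // i; rewrite ffunE.
    - exact: ha.
    - exact: hb.
move=> a aN; have [h1 h2 h3] := cell_sub01 R aN.
rewrite -mulrA mulr_ge0 ?divr_ge0//=.
by rewrite (le_trans _ (le_trans h2 h3))// ler_piMl// divr_ge0.
Qed.

Lemma sum_injective_const (R : realType) (n m : nat) (g : R) :
  (\sum_(M : {ffun 'I_n -> 'I_m} | injectiveb M) g%:E)%E = ((m ^_ n)%:R * g)%:E.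
Proof.
rewrite sumEFin sumr_const mulr_natl; congr ((_ *+ _)%:E).
by rewrite -[in RHS](card_ord n) -[in RHS](card_ord m) -card_inj_ffuns cardsE.
Qed.

Lemma expected_le_grid_sum (R : realType) (d : measure_display)
  (T : measurableType d) (P : probability T R) (n k N : nat) (lam eps c : R)
  (X Y : 'I_n -> 'I_(n + k) -> {RV P >-> R}) :
  random_market X Y -> (0 < N)%N -> 0 < lam -> 0 < eps ->
  c = expR (- (eps * lam)) ->
  (expected_nb_eps_stable lam eps X Y <=
   (((n + k) ^_ n)%:R * grid_sum n k N (fun a => c * a%:R / N%:R))%:E)%E.
Proof.
move=> rm N0 l0 e0 cE; rewrite expected_nb_eps_stableE -sum_injective_const.
by apply: lee_sum => M /injectiveP injM; exact: prob_eps_stable_le.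
Qed.

Lemma expected_ge_grid_sum (R : realType) (d : measure_display)
  (T : measurableType d) (P : probability T R) (n k N : nat) (lam eps c : R)
  (X Y : 'I_n -> 'I_(n + k) -> {RV P >-> R}) :
  random_market X Y -> 0 < lam -> 0 < eps ->
  expR (- (eps * lam)) <= c -> c <= 1 ->
  ((((n + k) ^_ n)%:R * grid_sum n k N (fun a => c * a.+1%:R / N%:R))%:E <=
   expected_nb_eps_stable lam eps X Y)%E.
Proof.
move=> rm l0 e0 ce c1; rewrite expected_nb_eps_stableE -sum_injective_const.
by apply: lee_sum => M /injectiveP injM; exact: prob_eps_stable_ge.
Qed.

(** * Averages of exponentials over the left ends of the cells *)

Lemma sub1_expRN_ge (R : realType) (w : R) : 0 <= w -> w / (1 + w) <= 1 - expR (- w).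
Proof.
move=> w0; have w1 : 0 < 1 + w by rewrite ltr_pwDl.
have h : expR (- w) <= (1 + w)^-1.
  by rewrite expRN lef_pV2 ?posrE ?expR_gt0// expR_ge1Dx.
suff : w / (1 + w) = 1 - (1 + w)^-1 by lra.
by field; lra.
Qed.

Lemma geometric_sum (R : realType) (w : R) (N : nat) :
  (1 - expR (- w)) * (\sum_(i < N) expR (- (w * i%:R))) = 1 - expR (- (w * N%:R)).
Proof.
have e i : expR (- (w * i%:R)) = expR (- w) ^+ i by rewrite -mulNr expRM_natr.
under eq_bigr do rewrite e.
by rewrite e -[RHS]opprB subrX1 -mulNr opprB.
Qed.

Lemma geometric_sum_le (R : realType) (w : R) (N : nat) : 0 < w ->
  \sum_(i < N) expR (- (w * i%:R)) <= (1 - expR (- (w * N%:R))) * ((1 + w) / w).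
Proof.
move=> w0; have h := sub1_expRN_ge (ltW w0).
have w1 : 0 < 1 + w by rewrite ltr_pwDl// ltW.
have h0 : 0 < w / (1 + w) by rewrite divr_gt0.
rewrite -geometric_sum mulrAC -[leLHS]mul1r ler_wpM2r//;
  first by apply: sumr_ge0 => i _; exact: expR_ge0.
by rewrite -[X in _ * X]invf_div ler_pdivlMr// mul1r.
Qed.

(** The ratio [(1 - exp(-z)) / z] decreases with [z], by concavity. *)
Lemma sub1_expRN_concave (R : realType) (z s : R) : 0 <= z -> z <= s ->
  z * (1 - expR (- s)) <= s * (1 - expR (- z)).
Proof.
move=> z0 zs.
have e1 : expR (- s) >= expR (- z) * (1 - (s - z)).
  rewrite (_ : - s = - z + - (s - z)); last by ring.
  by rewrite expRD ler_pM2l ?expR_gt0// expR_ge1Dx.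
have e2 : expR (- z) * (1 + z) <= 1.
  by rewrite expRN mulrC ler_pdivrMr ?expR_gt0// mul1r expR_ge1Dx.
move: e1 e2; set ez := expR (- z); set es := expR (- s) => e1 e2.
have : z * es >= z * (ez * (1 - (s - z))) by rewrite ler_wpM2l.
have : (s - z) * (ez * (1 + z)) <= s - z by rewrite ler_piMr// subr_ge0.
nra.
Qed.

(** Up to the factor [n`!], the left-hand side is the probability of [n]
    successes among [n + k] trials of parameter [1 - t]. *)
Lemma binomial_term_le1 (R : realType) (n k : nat) (t : R) : 0 <= t <= 1 ->
  ((n + k) ^_ n)%:R * ((1 - t) ^+ n * t ^+ k) <= n`!%:R.
Proof.
move=> /andP[t0 t1]; rewrite -bin_ffact natrM mulrAC ler_piMl// .
have e : 1 = (t + (1 - t)) ^+ (n + k) by rewrite addrC subrK expr1n.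
rewrite [leRHS]e [in leRHS]exprDn.
have nk : (n < (n + k).+1)%N by rewrite ltnS leq_addr.
rewrite (bigD1 (Ordinal nk)) //= addKn -[in leRHS]mulr_natl -[leLHS]addr0.
rewrite [in leLHS](mulrC ((1 - t) ^+ n)) lerD2l.
apply: sumr_ge0 => i _.
by rewrite mulrn_wge0// mulr_ge0// exprn_ge0// subr_ge0.
Qed.

(** A Riemann sum of the integral of [exp(- c * z * y)] over [y] in [0, 1]. *)
Definition left_mean (R : realType) (N : nat) (c z : R) : R :=
  N%:R^-1 * \sum_(b < N) expR (- (c * b%:R / N%:R * z)).

Lemma left_mean_ge0 (R : realType) (N : nat) (c z : R) : 0 <= left_mean N c z.
Proof. by rewrite mulr_ge0 ?invr_ge0// sumr_ge0// => i _; exact: expR_ge0. Qed.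

Lemma left_meanE (R : realType) (N : nat) (c z : R) : (0 < N)%N ->
  (1 - expR (- (c * z / N%:R))) * left_mean N c z = N%:R^-1 * (1 - expR (- (c * z))).
Proof.
move=> N0; have N0' : N%:R != 0 :> R by rewrite pnatr_eq0 -lt0n.
rewrite /left_mean mulrCA; congr (_ * _).
rewrite [in RHS](_ : c * z = c * z / N%:R * N%:R); last by field.
rewrite -geometric_sum; congr (_ * _); apply: eq_bigr => i _.
by congr (expR (- _)); field.
Qed.

Lemma left_mean_le (R : realType) (N : nat) (c s : R) : (0 < N)%N -> 0 < c -> c <= 1 ->
  0 < s ->
  left_mean N c s <= (1 - expR (- s)) * ((1 + c * s / N%:R) / (c * s)).
Proof.
move=> N0 c0 c1 s0; have N0' : 0 < N%:R :> R by rewrite ltr0n.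
have w0 : 0 < c * s / N%:R by rewrite divr_gt0 ?mulr_gt0.
rewrite /left_mean.
have -> : \sum_(b < N) expR (- (c * b%:R / N%:R * s)) =
          \sum_(b < N) expR (- (c * s / N%:R * b%:R)).
  by apply: eq_bigr => b _; congr (expR (- _)); field; rewrite gt_eqF.
have := geometric_sum_le N w0.
rewrite -(ler_pM2l (_ : 0 < N%:R^-1)) ?invr_gt0// => h; apply: le_trans h _.
have -> : c * s / N%:R * N%:R = c * s by field; rewrite gt_eqF.
have -> : N%:R^-1 * ((1 - expR (- (c * s))) * ((1 + c * s / N%:R) / (c * s / N%:R))) =
   (1 - expR (- (c * s))) * ((1 + c * s / N%:R) / (c * s)).
  by field; rewrite !gt_eqF.
rewrite ler_wpM2r//.
  by rewrite divr_ge0 ?addr_ge0 ?ltW// mulr_gt0.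
by rewrite lerD2l lerN2 ler_expR lerN2 ler_piMl// ltW.
Qed.

(** A given worker [j] meets the thresholds of all firms but his own, so his
    integral involves [s - x j] instead of [s].  The logarithm of [left_mean] has
    slope at most [min(1, 2/s)] there; as the [x j] add up to [s], the product
    over [j] of the corrections is bounded by [exp 2] whatever [n] is. *)
Lemma left_mean_shift (R : realType) (N : nat) (c s : R) : (0 < N)%N -> 0 < c -> c <=
  1 -> 0 <= s ->
  exists2 kappa : R, 0 <= kappa /\ kappa * s <= 2 &
    forall x, 0 <= x -> x <= 1 -> x <= s -> left_mean N c (s - x) <=
      expR (kappa * x) * left_mean N c s.
Proof.
move=> N0 c0 c1 s0; have N0' : 0 < N%:R :> R by rewrite ltr0n.
have [s2|s2] := leP s 2.
  (* for bounded [s] the exponential itself is Lipschitz *)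
  exists 1; first by rewrite mul1r.
  move=> x x0 x1 xs; rewrite /left_mean mulrCA ler_wpM2l ?invr_ge0 ?ler0n// mulr_sumr.
  apply: ler_sum => b _; rewrite -expRD ler_expR mul1r.
  rewrite mulrBr opprB addrC -[leRHS]addrC lerD2l ler_piMl//.
  have [h1 h2 h3] := cell_sub01 R (ltn_ord b).
  by rewrite -mulrA mulr_ile1 ?(ltW c0) ?(le_trans h2 h3).
exists (2 / s); first by rewrite divr_ge0// ?divfK// gt_eqF// (lt_trans _ s2).
move=> x x0 x1 xs.
have s00 : 0 < s by rewrite (lt_trans _ s2).
pose z := s - x; have z0 : 0 < z by rewrite /z; lra.
have w0 y : 0 < y -> 0 < 1 - expR (- (c * y / N%:R)).
  by move=> y0; rewrite subr_gt0 expR_lt1 oppr_lt0 divr_gt0 ?mulr_gt0.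
rewrite -(ler_pM2l (w0 _ z0)) left_meanE//.
have h1 : (z / s) * (1 - expR (- (c * s / N%:R))) <= 1 - expR (- (c * z / N%:R)).
  rewrite mulrAC ler_pdivrMr// [leRHS]mulrC.
  have cN : 0 < c / N%:R by rewrite divr_gt0.
  have e y : c * y / N%:R = c / N%:R * y by ring.
  have zs : z <= s by rewrite /z; lra.
  have := @sub1_expRN_concave R (c * z / N%:R) (c * s / N%:R).
  rewrite ![in X in X -> _]e mulr_ge0 ?(ltW cN) ?(ltW z0)// ler_pM2l// => /(_ isT zs).
  by rewrite !e -!(mulrA (c / N%:R)) ler_pM2l.
have h2 : 1 <= expR (2 / s * x) * (z / s).
  apply: (@le_trans _ _ ((1 + 2 / s * x) * (z / s))); last first.
    by rewrite ler_wpM2r ?expR_ge1Dx// divr_ge0// ltW.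
  have q : x / s <= 2^-1 by rewrite ler_pdivrMr//; lra.
  have q0 : 0 <= x / s by rewrite divr_ge0// ltW.
  have -> : (1 + 2 / s * x) * (z / s) = (1 + 2 * (x / s)) * (1 - x / s).
    by rewrite /z; field; rewrite gt_eqF.
  nra.
apply: (@le_trans _ _ (N%:R^-1 * (1 - expR (- (c * s))))).
  rewrite ler_pM2l ?invr_gt0// lerD2l lerN2 ler_expR lerN2 ler_pM2l// /z; lra.
rewrite -left_meanE// [leRHS]mulrA; apply: ler_wpM2r; first exact: left_mean_ge0.
apply: (@le_trans _ _ (expR (2 / s * x) * (z / s * (1 - expR (- (c * s / N%:R)))))).
  by rewrite mulrA ler_peMl// ltW// w0.
by rewrite mulrC ler_wpM2r// expR_ge0.
Qed.

(** * Rows of the grid sum and lattice points of a simplex *)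

(** For a fixed choice [a] of cells for the firms, the sum over the cells of the
    workers factors, because each factor of [stable_weight] involves one worker
    only. *)
Definition row_weight (R : realType) (n k N : nat) (u : nat -> R)
    (a : {ffun 'I_n -> 'I_N}) : R :=
  (\prod_i (1 - u (a i)) ^+ k) *
  \prod_j (N%:R^-1 * \sum_(b < N) \prod_(i | i != j) (1 - u (a i) * u b)).

Lemma grid_sumE (R : realType) (n k N : nat) (u : nat -> R) :
  grid_sum n k N u = N%:R ^- n * \sum_(a : {ffun 'I_n -> 'I_N}) row_weight k u a.
Proof.
rewrite /grid_sum -(pair_bigA _ (fun a b : {ffun 'I_n -> 'I_N} => N%:R ^- (2 * n) *
    stable_weight k (fun i => u (a i)) (fun i => u (b i)))) /=.
rewrite mulr_sumr; apply: eq_bigr => a _.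
rewrite /row_weight big_split /= prodr_const card_ord bigA_distr_bigA /=.
rewrite mul2n -addnn exprD invfM exprVn.
set S := (X in _ = _ * (_ * (_ * X))); set K := \prod_(i < n) _.
rewrite [RHS](_ : _ = N%:R ^- n * N%:R ^- n * K * S); last by ring.
rewrite mulr_sumr; apply: eq_bigr => b _; rewrite /stable_weight -!mulrA.
congr (_ * (_ * _)); rewrite mulrC; congr (_ * _).
rewrite (exchange_big_dep xpredT) //=.
by apply: eq_bigr => j _; apply: eq_bigl => i; rewrite eq_sym.
Qed.

Lemma ffact_le_exp (m n : nat) : (m ^_ n <= m ^ n)%N.
Proof.
by elim: n => // n IH; rewrite ffactnSr expnSr leq_mul// leq_subr.
Qed.

Lemma leq_card_inj (T T' : finType) (A : {pred T}) (B : {pred T'}) (f : T -> T') :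
  {in A &, injective f} -> {in A, forall x, f x \in B} -> (#|A| <= #|B|)%N.
Proof.
move=> injf fB; rewrite -(card_in_image injf) subset_leq_card//.
by apply/fintype.subsetP => _ /fintype.imageP[x xA ->]; exact: fB.
Qed.

Lemma card_simplex (n A : nat) :
  #|[pred a : {ffun 'I_n -> 'I_A.+1} | (\sum_i a i <= A)%N]| = 'C(n + A, n).
Proof.
rewrite -card_partial_ord_partitions cardsE; apply/eqP; rewrite eqn_leq; apply/andP;
  split.
  apply: (leq_card_inj (f := fun a : {ffun 'I_n -> 'I_A.+1} => tuple_of_finfun a)).
    by move=> a b _ _; exact: (can_inj (@tuple_of_finfunK _ _)).
  by move=> a; rewrite inE unfold_in /= -/(_ <= _)%N big_map big_enum.
apply: (leq_card_inj (f := fun a : n.-tuple 'I_A.+1 => finfun_of_tuple a)).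
  by move=> a b _ _; exact: (can_inj (@finfun_of_tupleK _ _)).
move=> a; rewrite unfold_in /= -/(_ <= _)%N big_tuple inE => h; apply: leq_trans h.
by rewrite leq_eqVlt; apply/orP; left; apply/eqP; apply: eq_bigr => i _; rewrite ffunE.
Qed.

Lemma leq_sum_ord (n : nat) (a : 'I_n -> nat) i : (a i <= \sum_j a j)%N.
Proof. by rewrite (bigD1 i)//= leq_addr. Qed.

Lemma card_level_le (n N A : nat) :
  (#|[pred a : {ffun 'I_n -> 'I_N} | \sum_i a i == A]| <= 'C(n + A, n))%N.
Proof.
rewrite -card_simplex.
have vE (a : {ffun 'I_n -> 'I_N}) i : (\sum_i a i)%N = A ->
  (inord (a i) : 'I_A.+1) = a i :> nat.
  by move=> aA; rewrite inordK// ltnS -[leqRHS]aA (leq_sum_ord (fun i => a i)).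
apply: (leq_card_inj (f := fun a : {ffun 'I_n -> 'I_N} => [ffun i =>
  inord (a i) : 'I_A.+1])).
  move=> a a'; rewrite !inE => /eqP aA /eqP a'A /ffunP e; apply/ffunP => i.
  by apply: val_inj; have := congr1 (@nat_of_ord _) (e i);
    rewrite !ffunE /= (vE _ _ aA) (vE _ _ a'A) => ->.
move=> a; rewrite inE => /eqP aA; rewrite inE (eq_bigr (fun i => a i : nat)) ?aA// => i _.
by rewrite ffunE vE.
Qed.

Lemma card_level_le_exp (n N A : nat) :
  (#|[pred a : {ffun 'I_n -> 'I_N} | \sum_i a i == A]| * n`! <= (n + A) ^ n)%N.
Proof.
by rewrite (leq_trans _ (ffact_le_exp _ _))// -bin_ffact leq_mul2r card_level_le orbT.
Qed.

Lemma sum_levels (R : realType) (n N : nat) (f : {ffun 'I_n -> 'I_N} -> R) :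
  \sum_a f a = \sum_(A < (n * N).+1) \sum_(a : {ffun 'I_n ->
    'I_N} | (\sum_i a i == A)%N) f a.
Proof.
have h (a : {ffun 'I_n -> 'I_N}) : (\sum_i a i < (n * N).+1)%N.
  rewrite ltnS -[X in (X * N)%N]card_ord -sum_nat_const.
  by apply: leq_sum => i _; exact: ltnW.
rewrite (partition_big (fun a => Ordinal (h a)) xpredT)//=.
Qed.

(** * Upper bound on the grid sum *)

Lemma prod_01 (R : numDomainType) (I : finType) (Q : pred I) (f : I -> R) :
  (forall i, 0 <= f i <= 1) -> 0 <= \prod_(i | Q i) f i <= 1.
Proof.
move=> f01; rewrite prodr_ge0 /= => [|i _]; last by case/andP: (f01 i).
apply: (@le_trans _ _ (\prod_(i | Q i) 1)); last by rewrite big1.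
by apply: ler_prod => i _; exact: f01.
Qed.

Lemma mean_le1 (R : realFieldType) (N : nat) (f : 'I_N -> R) :
  (forall i, 0 <= f i <= 1) -> 0 <= N%:R^-1 * (\sum_(b < N) f b) <= 1.
Proof.
case: N f => [|N] f f01; first by rewrite invr0 mul0r lexx ler01.
rewrite mulr_ge0 ?invr_ge0 ?ler0n ?sumr_ge0//=; last by move=> i _; case/andP: (f01 i).
rewrite mulrC ler_pdivrMr ?ltr0n// mul1r.
apply: (@le_trans _ _ (\sum_(b < N.+1) 1)); last by rewrite sumr_const card_ord.
by apply: ler_sum => i _; case/andP: (f01 i).
Qed.

Lemma row_factor_01 (R : realType) (n N : nat) (u : nat -> R) (a : {ffun 'I_n ->
  'I_N}) j :
  (forall a, (a < N)%N -> 0 <= u a <= 1) ->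
  0 <= N%:R^-1 * \sum_(b < N) \prod_(i | i != j) (1 - u (a i) * u b) <= 1.
Proof.
move=> u01; apply: mean_le1 => b; apply: prod_01 => i.
have /andP[h1 h2] := u01 _ (ltn_ord (a i)); have /andP[h3 h4] := u01 _ (ltn_ord b).
by rewrite subr_ge0 mulr_ile1//= gerBl mulr_ge0.
Qed.

Lemma row_weight_le_pow (R : realType) (n k N : nat) (u : nat -> R) (a : {ffun 'I_n ->
  'I_N}) :
  (forall a, (a < N)%N -> 0 <= u a <= 1) ->
  row_weight k u a <= \prod_i (1 - u (a i)) ^+ k.
Proof.
move=> u01; rewrite /row_weight ler_piMr//.
  by apply: prodr_ge0 => i _; rewrite exprn_ge0// subr_ge0;
    case/andP: (u01 _ (ltn_ord (a i))).
have /andP[] // := prod_01 xpredT (fun j => row_factor_01 a j u01).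
Qed.

Lemma row_weight_le1 (R : realType) (n k N : nat) (u : nat -> R) (a : {ffun 'I_n ->
  'I_N}) :
  (forall a, (a < N)%N -> 0 <= u a <= 1) -> row_weight k u a <= 1.
Proof.
move=> u01; apply: le_trans (row_weight_le_pow _ _ u01) _.
have /andP[] // : 0 <= \prod_i (1 - u (a i)) ^+ k <= 1.
apply: prod_01 => i; have /andP[h1 h2] := u01 _ (ltn_ord (a i)).
by rewrite exprn_ge0 ?subr_ge0//= exprn_ile1// ?subr_ge0// gerBl.
Qed.

Lemma expR_exprn (R : realType) (x : R) n : expR x ^+ n = expR (n%:R * x).
Proof. by rewrite expRM_natl. Qed.

(** The weight depends on [a] essentially through the sum [s] of the thresholds
    only: [1 - z <= exp(-z)] turns the products over the firms into exponentials
    of [s], and [left_mean_shift] repairs the missing diagonal factors. *)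
Lemma row_weight_level_le (R : realType) (n k N A : nat) (c s : R)
    (a : {ffun 'I_n -> 'I_N}) :
  (n * n <= N)%N -> 0 < c -> c <= 1 -> (0 < A)%N -> (\sum_i a i)%N = A ->
  s = c * A%:R / N%:R ->
  row_weight k (fun a => c * a%:R / N%:R) a <=
  expR 3 * ((1 - expR (- s)) ^+ n * expR (- s) ^+ k) * (c * s) ^- n.
Proof.
move=> nN c0 c1 A0 aA sE.
have n0 : (0 < n)%N.
  by case: n a nN aA => // a _; rewrite big_ord0 => A0'; rewrite -A0' in A0.
have N0 : (0 < N)%N by apply: leq_trans nN; rewrite muln_gt0 n0.
have N0' : 0 < N%:R :> R by rewrite ltr0n.
have s0 : 0 < s by rewrite sE divr_gt0// mulr_gt0// ltr0n.
pose u i : R := c * (a i)%:R / N%:R.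
have su : \sum_i u i = s.
  rewrite sE -aA natr_sum mulr_sumr mulr_suml; exact: eq_bigr.
have u0 i : 0 <= u i by rewrite /u divr_ge0// mulr_ge0// ltW.
have u1 i : u i <= 1.
  have [h1 h2 h3] := cell_sub01 R (ltn_ord (a i)).
  by rewrite /u -mulrA mulr_ile1 ?(ltW c0) ?(le_trans h2 h3).
have us i : u i <= s.
  by rewrite -su (bigD1 i)//= lerDl sumr_ge0.
have cbN (b : 'I_N) : 0 <= c * b%:R / N%:R <= 1.
  have [h1 h2 h3] := cell_sub01 R (ltn_ord b).
  by rewrite -mulrA mulr_ge0 ?(ltW c0)//= mulr_ile1 ?(ltW c0) ?(le_trans h2 h3).
have sn : s <= n%:R.
  rewrite -su; apply: le_trans (ler_sum _ (fun i _ => u1 i)) _.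
  by rewrite sumr_const card_ord.
have [kappa [k0 ks] kP] := left_mean_shift N0 c0 c1 (ltW s0).
have P1 : \prod_i (1 - u i) ^+ k <= expR (- s) ^+ k.
  rewrite prodrXl lerXn2r ?nnegrE ?expR_ge0//.
    by apply: prodr_ge0 => i _; rewrite subr_ge0.
  rewrite -su -sumrN expR_sum; apply: ler_prod => i _.
  by rewrite subr_ge0 u1 expR_ge1Dx.
have P2 : \prod_j (N%:R^-1 * \sum_(b < N) \prod_(i | i != j)
  (1 - u i * (c * b%:R / N%:R)))
   <= expR 2 * left_mean N c s ^+ n.
  apply: (@le_trans _ _ (\prod_(j < n) (expR (kappa * u j) * left_mean N c s))).
    apply: ler_prod => j _; apply/andP; split.
      rewrite mulr_ge0 ?invr_ge0// sumr_ge0// => b _; rewrite prodr_ge0// => i _.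
      by rewrite subr_ge0 mulr_ile1//; case/andP: (cbN b).
    apply: le_trans (kP _ (u0 j) (u1 j) (us j)).
    rewrite /left_mean ler_wpM2l ?invr_ge0//; apply: ler_sum => b _.
    have -> : s - u j = \sum_(i | i != j) u i.
      by rewrite -su (bigD1 j)//= addrC addrK.
    rewrite mulr_sumr -sumrN expR_sum; apply: ler_prod => i _.
    rewrite subr_ge0 mulr_ile1 ?u0 ?u1 //=; try by case/andP: (cbN b).
    by rewrite mulrC expR_ge1Dx.
  rewrite big_split/= prodr_const card_ord -expR_sum -mulr_sumr su.
  by rewrite ler_wpM2r ?exprn_ge0 ?left_mean_ge0// ler_expR.
have P3 : left_mean N c s ^+ n <= (1 - expR (- s)) ^+ n * (expR 1 * (c * s) ^- n).
  have h := left_mean_le N0 c0 c1 s0.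
  apply: (@le_trans _ _ (((1 - expR (- s)) * ((1 + c * s / N%:R) / (c * s))) ^+ n)).
    by rewrite lerXn2r ?nnegrE ?left_mean_ge0// (le_trans (left_mean_ge0 _ _ _) h).
  rewrite exprMn ler_wpM2l ?exprn_ge0 ?subr_ge0 ?expR_le1 ?oppr_le0 ?(ltW s0)//.
  rewrite expr_div_n ler_wpM2r ?invr_ge0 ?exprn_ge0 ?mulr_ge0 ?(ltW c0) ?(ltW s0)//.
  have p0 : 0 <= c * s / N%:R by rewrite divr_ge0// mulr_ge0// ltW.
  apply: (@le_trans _ _ (expR (c * s / N%:R) ^+ n)).
    by rewrite lerXn2r ?nnegrE ?expR_ge0 ?addr_ge0 ?expR_ge1Dx.
  rewrite expR_exprn ler_expR mulrA ler_pdivrMr// mul1r.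
  apply: (@le_trans _ _ (n%:R * n%:R)); last by rewrite -natrM ler_nat.
  by rewrite ler_wpM2l// (le_trans _ sn)// ler_piMl// ltW.
have e1 : 0 <= expR (- s) ^+ k by rewrite exprn_ge0// expR_ge0.
rewrite /row_weight; apply: (@le_trans _ _ (expR (- s)
  ^+ k * (expR 2 * left_mean N c s ^+ n))).
  apply: ler_pM => //.
    by apply: prodr_ge0 => i _; rewrite exprn_ge0// subr_ge0 u1.
  apply: prodr_ge0 => j _; rewrite mulr_ge0 ?invr_ge0// sumr_ge0// => b _;
    rewrite prodr_ge0// => i _.
  by rewrite subr_ge0 -/(u i) mulr_ile1//; case/andP: (cbN b).
apply: (@le_trans _ _ (expR (- s) ^+ k * (expR 2 * ((1 - expR (- s))
  ^+ n * (expR 1 * (c * s) ^- n))))).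
  by rewrite ler_wpM2l// ler_wpM2l// expR_ge0.
have <- : expR 2 * expR 1 = expR 3 :> R by rewrite -expRD; congr expR; ring.
set v := ((c * s) ^+ n)^-1; set e := expR (- s); set e1' := expR 1; set e2 := expR 2.
by rewrite le_eqVlt; apply/orP; left; apply/eqP; ring.
Qed.

Lemma cell_scaled_01 (R : realType) (N : nat) (c : R) : 0 <= c -> c <= 1 ->
  forall a, (a < N)%N -> 0 <= c * a%:R / N%:R <= 1.
Proof.
move=> c0 c1 a aN; have [h1 h2 h3] := cell_sub01 R aN.
by rewrite -mulrA mulr_ge0//= mulr_ile1// (le_trans h2 h3).
Qed.

Lemma row_weight_ge0 (R : realType) (n k N : nat) (u : nat -> R) (a : {ffun 'I_n ->
  'I_N}) :
  (forall a, (a < N)%N -> 0 <= u a <= 1) -> 0 <= row_weight k u a.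
Proof.
move=> u01; rewrite mulr_ge0//; apply: prodr_ge0 => i _.
  by rewrite exprn_ge0// subr_ge0; case/andP: (u01 _ (ltn_ord (a i))).
by case/andP: (row_factor_01 a i u01).
Qed.

Lemma expr1D_le_expR (R : realType) (x : R) n : 0 <= x -> (1 + x) ^+ n <= expR (n%:R * x).
Proof.
by move=> x0; rewrite -expR_exprn lerXn2r ?nnegrE ?expR_ge0 ?addr_ge0 ?expR_ge1Dx.
Qed.

(** For [A < n ^ 2] the level is so small that the bound [1] on the weights is
    enough, thanks to [N = 4 * n ^ 4].  For the other levels the number of
    lattice points, at most [(n + A) ^ n / n`!], is within a constant factor of
    [A ^ n / n`!]; the powers of [A] cancel and a binomial probability remains. *)
Lemma grid_level_le (R : realType) (n k A : nat) (c : R) (N := (4 * n ^ 4)%N) :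
  (0 < n)%N -> (k < n ^ 2)%N -> 0 < c -> c <= 1 ->
  ((n + k) ^_ n)%:R * (N%:R ^- n *
    \sum_(a : {ffun 'I_n -> 'I_N} | (\sum_i a i == A)%N) row_weight k (fun a =>
      c * a%:R / N%:R) a)
  <= expR 4 * c ^- (2 * n).
Proof.
move=> n0 kn c0 c1.
have N0 : (0 < N)%N by rewrite muln_gt0 expn_gt0 n0.
have N0' : 0 < N%:R :> R by rewrite ltr0n.
have n2 : (n <= n ^ 2)%N by rewrite -mulnn leq_pmulr.
have u01 := cell_scaled_01 (N := N) (ltW c0) c1.
have c2n : 0 < c ^- (2 * n) by rewrite invr_gt0 exprn_gt0.
pose L := [pred a : {ffun 'I_n -> 'I_N} | (\sum_i a i == A)%N].
have sumL (w : R) : \sum_(a : {ffun 'I_n -> 'I_N} | (\sum_i a i == A)%N) w = #|L|%:R * w.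
  by rewrite sumr_const mulr_natl.
have cardL : #|L|%:R * n`!%:R <= (n + A)%:R ^+ n :> R.
  by rewrite -natrM -natrX ler_nat; exact: card_level_le_exp.
(* below [n ^ 2] the factor [((n + A) / A) ^ n] would not be bounded *)
have [An|An] := ltnP A (n ^ 2).
  apply: (@le_trans _ _ 1); last first.
    apply: (@le_trans _ _ (expR 4)); first by rewrite -[leLHS]expR0 ler_expR.
    by rewrite ler_peMr ?expR_ge0// invf_ge1 ?exprn_gt0// exprn_ile1// ltW.
  apply: (@le_trans _ _ ((n + k)%:R ^+ n * (N%:R ^- n * (n + A)%:R ^+ n))).
    rewrite ler_pM//.
    - by rewrite mulr_ge0 ?invr_ge0 ?exprn_ge0// sumr_ge0// => a _; exact: row_weight_ge0.
    - by rewrite -natrX ler_nat ffact_le_exp.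
    - rewrite ler_wpM2l ?invr_ge0 ?exprn_ge0//; apply: le_trans cardL.
      apply: (@le_trans _ _ (#|L|%:R * 1)).
        by rewrite -sumL; apply: ler_sum => a _; exact: row_weight_le1.
      by rewrite ler_wpM2l// ler1n fact_gt0.
  rewrite mulrCA -exprMn mulrC ler_pdivrMr ?exprn_gt0// mul1r lerXn2r ?nnegrE//.
  rewrite -natrM ler_nat /N -[(4 * n ^ 4)%N]/((2 * 2) * n ^ (2 + 2))%N expnD mulnACA.
  by rewrite leq_mul// mul2n -addnn leq_add// ltnW.
have A0 : (0 < A)%N by apply: leq_trans An; rewrite expn_gt0 n0.
pose s : R := c * A%:R / N%:R.
have A0' : 0 < A%:R :> R by rewrite ltr0n.
have s0 : 0 < s by rewrite divr_gt0 ?mulr_gt0.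
have nN : (n * n <= N)%N.
  rewrite mulnn /N (leq_trans (_ : _ <= n ^ 4)%N) ?leq_pmull//.
  by rewrite leq_pexp2l.
pose v : R := (c * s) ^- n.
have v0 : 0 < v by rewrite invr_gt0 exprn_gt0// mulr_gt0.
have hrow : \sum_(a : {ffun 'I_n -> 'I_N} | (\sum_i a i == A)%N) row_weight k (fun a =>
  c * a%:R / N%:R) a
   <= #|L|%:R * (expR 3 * ((1 - expR (- s)) ^+ n * expR (- s) ^+ k) * v).
  rewrite -sumL; apply: ler_sum => a /eqP aA.
  exact: (row_weight_level_le k nN c0 c1 A0 aA erefl).
have hbin : ((n + k) ^_ n)%:R * ((1 - expR (- s)) ^+ n * expR (- s) ^+ k) <= n`!%:R.
  by apply: binomial_term_le1; rewrite expR_ge0 expR_le1 oppr_le0 ltW.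
apply: (@le_trans _ _ (N%:R ^- n * (expR 3 * v * (#|L|%:R * n`!%:R)))).
  rewrite mulrCA ler_wpM2l ?invr_ge0 ?exprn_ge0//.
  apply: (le_trans (ler_wpM2l _ hrow)) => //.
  move: hbin; set b := _ * _ => hbin.
  have e3 : 0 <= expR 3 * v * #|L|%:R by rewrite mulr_ge0// mulr_ge0 ?expR_ge0// ltW.
  rewrite [leRHS]mulrA; apply: le_trans (ler_wpM2l e3 hbin).
  by rewrite /b le_eqVlt; apply/orP; left; apply/eqP; ring.
apply: (@le_trans _ _ (N%:R ^- n * (expR 3 * v * (n + A)%:R ^+ n))).
  rewrite ler_wpM2l ?invr_ge0 ?exprn_ge0// ler_wpM2l// mulr_ge0 ?expR_ge0// ltW//.
have -> : N%:R ^- n * (expR 3 * v * (n + A)%:R ^+ n) =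
   expR 3 * c ^- (2 * n) * (1 + n%:R / A%:R) ^+ n.
  have -> : 1 + n%:R / A%:R = (n + A)%:R / A%:R :> R.
    by rewrite natrD; field; rewrite gt_eqF.
  rewrite /v /s !exprMn !exprVn exprM [c ^+ 2]expr2 exprMn.
  by field; rewrite !expf_neq0 ?gt_eqF.
have <- : expR 3 * expR 1 = expR 4 :> R by rewrite -expRD; congr expR; ring.
rewrite [leRHS]mulrAC ler_wpM2l ?mulr_ge0 ?expR_ge0 ?(ltW c2n)//.
apply: le_trans (expr1D_le_expR _ _) _; first by rewrite divr_ge0.
by rewrite ler_expR mulrA ler_pdivrMr// mul1r -natrM ler_nat mulnn.
Qed.

Lemma grid_sum_le_few_extra (R : realType) (n k : nat) (c : R) (N := (4 * n ^ 4)%N) :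
  (0 < n)%N -> (k < n ^ 2)%N -> 0 < c -> c <= 1 ->
  ((n + k) ^_ n)%:R * grid_sum n k N (fun a => c * a%:R / N%:R)
  <= expR 4 * c ^- (2 * n) * (5 * n ^ 5)%:R.
Proof.
move=> n0 kn c0 c1; rewrite grid_sumE sum_levels !mulr_sumr.
apply: (@le_trans _ _ (\sum_(A < (n * N).+1) (expR 4 * c ^- (2 * n)))).
  by apply: ler_sum => A _; exact: grid_level_le.
rewrite sumr_const card_ord -[leLHS]mulr_natr ler_wpM2l ?mulr_ge0 ?expR_ge0 ?invr_ge0
  ?exprn_ge0 ?(ltW c0)//.
rewrite ler_nat /N mulnCA -expnS -addn1 -[leqRHS]/((4 + 1)
  * n ^ 5)%N mulnDl leq_add2l mul1n.
by rewrite expn_gt0 n0.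
Qed.

(** When [k >= n ^ 2] the unmatched workers alone keep the expectation bounded:
    each firm contributes at most about [1 / (c * k)], against
    [(n + k) ^ n] matchings. *)
Lemma grid_sum_le_many_extra (R : realType) (n k : nat) (c : R) (N := (k * n)%N) :
  (0 < n)%N -> (n ^ 2 <= k)%N -> 0 < c -> c <= 1 ->
  ((n + k) ^_ n)%:R * grid_sum n k N (fun a => c * a%:R / N%:R)
  <= expR 2 * c ^- n.
Proof.
move=> n0 kn c0 c1.
have k0 : (0 < k)%N by apply: leq_trans kn; rewrite expn_gt0 n0.
have k0' : 0 < k%:R :> R by rewrite ltr0n.
have n0' : 0 < n%:R :> R by rewrite ltr0n.
have N0 : (0 < N)%N by rewrite muln_gt0 k0.
have N0' : 0 < N%:R :> R by rewrite ltr0n.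
have u01 := cell_scaled_01 (N := N) (ltW c0) c1.
pose w := c / n%:R; have w0 : 0 < w by rewrite divr_gt0.
have h1 : grid_sum n k N (fun a => c * a%:R / N%:R) <=
   (N%:R^-1 * \sum_(a < N) expR (- (w * a%:R))) ^+ n.
  rewrite grid_sumE exprMn exprVn ler_wpM2l ?invr_ge0 ?exprn_ge0//.
  have -> : (\sum_(a < N) expR (- (w * a%:R))) ^+ n =
     \prod_(i < n) \sum_(a < N) expR (- (w * a%:R)) by rewrite prodr_const card_ord.
  rewrite bigA_distr_bigA/=; apply: ler_sum => a _.
  apply: le_trans (row_weight_le_pow _ _ u01) _.
  apply: ler_prod => i _; have /andP[h1 h2] := u01 _ (ltn_ord (a i)).
  rewrite exprn_ge0 ?subr_ge0//=.
  have -> : expR (- (w * (a i)%:R)) = expR (- (c * (a i)%:R / N%:R)) ^+ k.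
    rewrite expR_exprn; congr expR; rewrite /w /N natrM; field; rewrite !gt_eqF//.
  by rewrite lerXn2r ?nnegrE ?subr_ge0 ?expR_ge0// expR_ge1Dx.
have h2 : N%:R^-1 * \sum_(a < N) expR (- (w * a%:R)) <= (1 + w) / (c * k%:R).
  have -> : (1 + w) / (c * k%:R) = N%:R^-1 * ((1 + w) / w).
    by rewrite /w /N natrM; field; rewrite !gt_eqF.
  rewrite ler_wpM2l ?invr_ge0 ?ler0n//.
  apply: le_trans (geometric_sum_le N w0) _.
  apply: ler_piMl; last by rewrite gerBl expR_ge0.
  by rewrite divr_ge0 ?addr_ge0 ?(ltW w0).
have h3 : 0 <= N%:R^-1 * \sum_(a < N) expR (- (w * a%:R)).
  by rewrite mulr_ge0 ?invr_ge0 ?ler0n// sumr_ge0// => a _; exact: expR_ge0.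
have h4 : ((n + k) ^_ n)%:R <= (n + k)%:R ^+ n :> R by rewrite -natrX ler_nat
  ffact_le_exp.
have h12 := le_trans h1 (lerXn2r n h3 (le_trans h3 h2) h2).
apply: (@le_trans _ _ ((n + k)%:R ^+ n * ((1 + w) / (c * k%:R)) ^+ n)).
  apply: (@le_trans _ _ (((n + k) ^_ n)%:R * ((1 + w) / (c * k%:R)) ^+ n)).
    by rewrite ler_wpM2l.
  by rewrite ler_wpM2r// exprn_ge0// (le_trans h3 h2).
have -> : (n + k)%:R ^+ n * ((1 + w) / (c * k%:R)) ^+ n =
    ((1 + n%:R / k%:R) ^+ n * (1 + w) ^+ n) * c ^- n.
  rewrite -exprMn -exprMn -exprVn -exprMn; congr (_ ^+ n).
  by rewrite natrD; field; rewrite !gt_eqF.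
rewrite ler_wpM2r ?invr_ge0 ?exprn_ge0 ?(ltW c0)//.
have <- : expR 1 * expR 1 = expR 2 :> R by rewrite -expRD.
have nk0 : 0 <= n%:R / k%:R :> R by rewrite divr_ge0.
apply: ler_pM; rewrite ?exprn_ge0 ?addr_ge0 ?(ltW w0)//.
  apply: le_trans (expr1D_le_expR _ nk0) _.
  by rewrite ler_expR mulrA ler_pdivrMr// mul1r -natrM ler_nat mulnn.
apply: le_trans (expr1D_le_expR _ (ltW w0)) _.
by rewrite ler_expR /w mulrC divfK ?gt_eqF.
Qed.

Lemma grid_sum_le_poly (R : realType) (n k : nat) (c : R) :
  (0 < n)%N -> 0 < c -> c <= 1 ->
  exists2 N, (0 < N)%N &
  ((n + k) ^_ n)%:R * grid_sum n k N (fun a => c * a%:R / N%:R)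
  <= expR 4 * c ^- (2 * n) * (5 * n ^ 5)%:R.
Proof.
move=> n0 c0 c1; have [kn|kn] := ltnP k (n ^ 2).
  exists (4 * n ^ 4)%N; first by rewrite muln_gt0 expn_gt0 n0.
  exact: grid_sum_le_few_extra.
exists (k * n)%N.
  by rewrite muln_gt0 n0 andbT (leq_trans _ kn)// expn_gt0 n0.
apply: le_trans (grid_sum_le_many_extra n0 kn c0 c1) _.
rewrite -[leLHS]mulr1; apply: ler_pM; rewrite ?mulr_ge0 ?expR_ge0 ?invr_ge0 ?exprn_ge0
  ?(ltW c0)//.
  apply: ler_pM; rewrite ?expR_ge0 ?invr_ge0 ?exprn_ge0 ?(ltW c0)//.
    by rewrite ler_expR ler_nat.
  rewrite lef_pV2 ?posrE ?exprn_gt0//; apply: ler_wiXn2l; rewrite ?(ltW c0)//.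
  by rewrite leq_pmull.
by rewrite ler1n muln_gt0 expn_gt0 n0.
Qed.

(** * Lattice points of a simplex with small coordinates *)

(** Subtracting [B] from the coordinate [i0] maps these points into a smaller
    simplex. *)
Lemma card_simplex_large_coord (n D B : nat) (i0 : 'I_n) :
  (#|[pred a : {ffun 'I_n -> 'I_D.+1} | (\sum_i a i <= D)%N & (B <= a i0)%N]|
   <= 'C(n + D - B, n))%N.
Proof.
have [DB|BD] := ltnP D B.
  rewrite eq_card0// => a; rewrite !inE; apply/negP => /andP[_ Ba].
  by have := leq_trans DB Ba; rewrite ltnNge -ltnS ltn_ord.
rewrite -addnBA// -card_simplex.
pose g (a : {ffun 'I_n -> 'I_D.+1}) i : nat := if i == i0 then (a i - B)%N else a i.
have gsum (a : {ffun 'I_n -> 'I_D.+1}) : (\sum_i a i <= D)%N -> (B <= a i0)%N ->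
  (\sum_i g a i <= D - B)%N.
  move=> aD Ba; rewrite leq_subRL// (leq_trans _ aD)//.
  rewrite [leqRHS](bigD1 i0)//= [X in (_ + X <=
    _)%N](bigD1 i0)//= {1}/g eqxx addnA subnKC//.
  rewrite leq_add2l leq_sum// => i ii0; rewrite /g (negPf ii0)//.
have gE (a : {ffun 'I_n -> 'I_D.+1}) i : (\sum_i a i <= D)%N -> (B <= a i0)%N ->
  (inord (g a i) : 'I_(D - B).+1) = g a i :> nat.
  by move=> aD Ba; rewrite inordK// ltnS (leq_trans _ (gsum a aD Ba))// leq_sum_ord.
apply: (leq_card_inj (f := fun a : {ffun 'I_n -> 'I_D.+1} => [ffun i =>
  inord (g a i) : 'I_(D - B).+1])).
  move=> a a'; rewrite !inE => /andP[aD Ba] /andP[aD' Ba'] /ffunP e; apply/ffunP => i.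
  apply: val_inj; have := congr1 (@nat_of_ord _) (e i).
  rewrite !ffunE gE// gE// /g; case: eqP => // -> h.
  by rewrite /= -(subnK Ba) h subnK.
move=> a; rewrite inE => /andP[aD Ba]; rewrite inE.
rewrite (eq_bigr (fun i => g a i)) ?gsum// => i _.
by rewrite ffunE gE.
Qed.

Lemma card_simplex_small_coords (n D B N : nat) : (B <= N.+1)%N ->
  ('C(n + D, n) <= #|[pred a : {ffun 'I_n -> 'I_N.+1} |
      (\sum_i a i <= D)%N & [forall i, (a i < B)%N]]| + n * 'C(n + D - B, n))%N.
Proof.
move=> BN; rewrite -card_simplex.
pose S := [pred a : {ffun 'I_n -> 'I_D.+1} | (\sum_i a i <= D)%N].
pose Q := [pred a : {ffun 'I_n -> 'I_D.+1} | [forall i, (a i < B)%N]].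
rewrite -/S -(cardID Q S) leq_add//.
  have vE (a : {ffun 'I_n -> 'I_D.+1}) i : [forall i, (a i < B)%N] ->
      (inord (a i) : 'I_N.+1) = a i :> nat.
    by move=> /forallP aB; rewrite inordK// (leq_trans _ BN).
  apply: (leq_card_inj (f := fun a : {ffun 'I_n -> 'I_D.+1} => [ffun i =>
    inord (a i) : 'I_N.+1])).
    move=> a a'; rewrite !inE => /andP[_ aB] /andP[_ aB'] /ffunP e; apply/ffunP => i.
    by apply: val_inj; have := congr1 (@nat_of_ord _) (e i); rewrite !ffunE vE// vE.
  move=> a; rewrite !inE => /andP[aD aB].
  rewrite (eq_bigr (fun i => a i : nat)) => [|i _]; last by rewrite ffunE vE.
  by rewrite aD /=; apply/forallP => i; rewrite ffunE vE//; exact: (forallP aB).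
apply: (@leq_trans (\sum_(i < n) #|[pred a : {ffun 'I_n -> 'I_D.+1} | (\sum_i a i <=
  D)%N & (B <= a i)%N]|)).
  rewrite -sum1_card; under [X in (_ <= X)%N]eq_bigr do rewrite -sum1_card big_mkcond /=.
  rewrite exchange_big /= big_mkcond /=; apply: leq_sum => a _.
  case: ifP => //; rewrite !inE => /andP[/forallPn[i]]; rewrite -leqNgt => Ba aD.
  by rewrite (bigD1 i)//= inE aD Ba.
rewrite -[X in (X * 'C(_, _))%N](card_ord n) -sum_nat_const.
by apply: leq_sum => i _; exact: card_simplex_large_coord.
Qed.

(** Each factor of the falling factorial satisfies
    [(A - B - i) / (A - i) <= (A - B) / A]. *)
Lemma ffact_sub_ratio (A B n : nat) : (B <= A)%N ->
  ((A - B) ^_ n * A ^ n <= A ^_ n * (A - B) ^ n)%N.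
Proof.
move=> BA; elim: n => // n IH; rewrite !ffactnSr !expnSr mulnACA [leqRHS]mulnACA.
rewrite leq_mul//; nia.
Qed.

(** * Averages of exponentials over the right ends of the cells *)

(** From [1 - z = 1 / (1 + z / (1 - z)) >= exp(- z / (1 - z))]. *)
Lemma expRN_le_sub1 (R : realType) (z : R) : 0 <= z -> z <= 2^-1 ->
  expR (- (z + 2 * z ^+ 2)) <= 1 - z.
Proof.
move=> z0 z1; have z1' : 0 < 1 - z by lra.
have h : (1 - z)^-1 <= expR (z / (1 - z)).
  by rewrite (le_trans _ (expR_ge1Dx _))// le_eqVlt; apply/orP; left; apply/eqP; field;
    lra.
rewrite -[leRHS]invrK; rewrite expRN lef_pV2 ?posrE ?expR_gt0 ?invr_gt0//.
apply: le_trans h _; rewrite ler_expR ler_pdivrMr//; nra.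
Qed.

Lemma sqr_le_expR (R : realType) (z : R) : 0 <= z -> z ^+ 2 <= 8 * expR (z / 2).
Proof.
move=> z0; have h := @expR_ge1Dxn R (z / 2) 1 (divr_ge0 z0 (ler0n _ _)).
have : (2`!)%:R = 2 :> R by [].
move: h => /[swap] ->; rewrite expr_div_n; nra.
Qed.

Definition right_mean (R : realType) (N : nat) (s : R) : R :=
  N%:R^-1 * \sum_(b < N) expR (- (s * (b.+1%:R / N%:R))).

Lemma right_meanE (R : realType) (N : nat) (s : R) :
  right_mean N s = N%:R^-1 * (expR (- (s / N%:R)) * \sum_(b < N)
    expR (- (s / N%:R * b%:R))).
Proof.
rewrite /right_mean [in RHS]mulr_sumr; congr (_ * _); apply: eq_bigr => b _.
by rewrite -expRD; congr expR; rewrite -natr1; ring.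
Qed.

Lemma right_mean_ge0 (R : realType) (N : nat) (s : R) : 0 <= right_mean N s.
Proof. by rewrite mulr_ge0 ?invr_ge0// sumr_ge0// => i _; exact: expR_ge0. Qed.

Lemma right_mean_ge (R : realType) (N : nat) (s : R) : (0 < N)%N -> 0 < s ->
  expR (- (s / N%:R)) * ((1 - expR (- s)) / s) <= right_mean N s.
Proof.
move=> N0 s0; have N0' : 0 < N%:R :> R by rewrite ltr0n.
rewrite right_meanE [leRHS]mulrCA ler_wpM2l ?expR_ge0//.
have w0 : 0 < s / N%:R by rewrite divr_gt0.
have := geometric_sum (s / N%:R) N; rewrite divfK ?gt_eqF// => <-.
have h : 1 - expR (- (s / N%:R)) <= s / N%:R.
  have := expR_ge1Dx (- (s / N%:R)); lra.
set S := \sum_(i < N) _.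
have S0 : 0 <= S by rewrite sumr_ge0// => i _; exact: expR_ge0.
rewrite mulrAC ler_wpM2r// ler_pdivrMr// [leRHS]mulrC.
exact: h.
Qed.

(** Halving the rate changes the integral of [exp(- s * y)] by a bounded factor
    only: with [h = exp(- s / (2 * N))] the two sums are [\sum h ^ b] and
    [\sum h ^ (2 * b)], whose ratio is [(1 + h) / (1 + h ^ N)] at most [2]. *)
Lemma right_mean_half (R : realType) (N : nat) (s : R) : (0 < N)%N -> 0 <= s -> s <=
  N%:R ->
  right_mean N (s / 2) <= 4 * right_mean N s.
Proof.
move=> N0 s0 sN; have N0' : 0 < N%:R :> R by rewrite ltr0n.
rewrite !right_meanE [leRHS]mulrCA ler_pM2l ?invr_gt0//.
set h := expR (- (s / 2 / N%:R)).
have hh : expR (- (s / N%:R)) = h ^+ 2.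
  by rewrite expR_exprn; congr expR; field; rewrite gt_eqF.
have e1 b : expR (- (s / 2 / N%:R * b%:R)) = h ^+ b.
  by rewrite expR_exprn; congr expR; ring.
have e2 b : expR (- (s / N%:R * b%:R)) = h ^+ 2 ^+ b.
  by rewrite -hh expR_exprn; congr expR; ring.
rewrite hh (eq_bigr (fun b : 'I_N => h ^+ b)) => [|b _]; last exact: e1.
rewrite [in leRHS](eq_bigr (fun b : 'I_N => h ^+ 2 ^+ b)) => [|b _]; last exact: e2.
have h0 : 0 < h by exact: expR_gt0.
have h1 : h <= 1 by rewrite expR_le1 oppr_le0 !divr_ge0.
have h2 : 2^-1 <= h.
  apply: le_trans (expR_ge1Dx _); have : s / 2 / N%:R <= 2^-1.
    by rewrite ler_pdivrMr//; lra.
  lra.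
(* the geometric sum formula divides by [1 - h] *)
have [->|hn1] := eqVneq h 1.
  by rewrite !expr1n !mul1r ler_peMl ?ler1n// sumr_ge0// => b _; rewrite exprn_ge0.
set S1 := \sum_(b < N) h ^+ b; set S2 := \sum_(b < N) (h ^+ 2) ^+ b.
have S10 : 0 <= S1 by rewrite sumr_ge0// => b _; rewrite exprn_ge0// ltW.
have S20 : 0 <= S2 by rewrite sumr_ge0// => b _; rewrite exprn_ge0// exprn_ge0// ltW.
have key : S1 <= 2 * S2.
  have k1 : 1 - h ^+ N = (1 - h) * S1 by rewrite -[LHS]opprB subrX1 -mulNr opprB.
  have k2 : 1 - (h ^+ 2) ^+ N = (1 - h ^+ 2) * S2 by rewrite -[LHS]opprB subrX1 -mulNr
    opprB.
  have hlt : 0 < 1 - h by rewrite subr_gt0 lt_neqAle hn1.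
  have k3 : (1 - h) * (S1 * (1 + h ^+ N)) = (1 - h) * ((1 + h) * S2).
    have -> : (1 - h) * (S1 * (1 + h ^+ N)) = (1 - h ^+ N) * (1 + h ^+ N) by rewrite k1;
      ring.
    have -> : (1 - h) * ((1 + h) * S2) = (1 - h ^+ 2) * S2 by ring.
    by rewrite -k2 exprAC; ring.
  have k4 : S1 * (1 + h ^+ N) = (1 + h) * S2 by apply: (mulfI (lt0r_neq0 hlt)).
  have hN : 0 <= h ^+ N by rewrite exprn_ge0// ltW.
  have : S1 * 1 <= S1 * (1 + h ^+ N) by rewrite ler_wpM2l// lerDl.
  have : (1 + h) * S2 <= 2 * S2 by rewrite ler_wpM2r//; lra.
  by rewrite k4 mulr1 => u v; exact: le_trans v u.
have : h * S1 <= h * (2 * S2) by rewrite ler_wpM2l// ltW.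
have : h * S2 * 2^-1 <= h * S2 * h by rewrite ler_wpM2l// mulr_ge0// ltW.
rewrite expr2; nra.
Qed.

(** Under the density proportional to [exp(- s * y)] the mean of [y ^ 2] is
    [O(1 / s ^ 2)], so a quadratic perturbation of the exponent costs a factor
    [exp(- O(q / s ^ 2))].  The second moment is reduced to [right_mean_half] by
    [(s * y) ^ 2 <= 8 * exp(s * y / 2)]. *)
Lemma right_mean_quadratic (R : realType) (N : nat) (s q : R) :
  (0 < N)%N -> 0 < s -> s <= N%:R -> 0 <= q -> 32 * q / s ^+ 2 <= 2^-1 ->
  expR (- (64 * q / s ^+ 2)) * right_mean N s <=
  N%:R^-1 * \sum_(b < N) expR (- (s * (b.+1%:R / N%:R) + q * (b.+1%:R / N%:R) ^+ 2)).
Proof.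
move=> N0 s0 sN q0 qs; have N0' : 0 < N%:R :> R by rewrite ltr0n.
have s2 : 0 < s ^+ 2 by rewrite exprn_gt0.
pose z := 32 * q / s ^+ 2.
have z0 : 0 <= z by rewrite /z divr_ge0 ?(ltW s2)// mulr_ge0.
apply: (@le_trans _ _ ((1 - z) * right_mean N s)).
  rewrite ler_wpM2r ?right_mean_ge0//; apply: le_trans (expRN_le_sub1 z0 qs).
  rewrite ler_expR lerN2.
  have -> : 64 * q / s ^+ 2 = 2 * z by rewrite /z; field; rewrite gt_eqF.
  have : z <= 2^-1 by [].
  nra.
have h := right_mean_half N0 (ltW s0) sN.
have q8 : 0 <= 8 * q / s ^+ 2 by rewrite divr_ge0 ?(ltW s2)// mulr_ge0.
apply: (@le_trans _ _ (right_mean N s - 8 * q / s ^+ 2 * right_mean N (s / 2))).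
  have := ler_wpM2l q8 h; rewrite /z.
  have -> : 32 * q / s ^+ 2 = 8 * q / s ^+ 2 * 4 by ring.
  lra.
rewrite /right_mean mulrCA -mulrBr ler_wpM2l ?invr_ge0 ?ler0n//.
rewrite mulr_sumr -sumrB; apply: ler_sum => b _.
set y := b.+1%:R / N%:R.
have y0 : 0 <= y by rewrite divr_ge0.
rewrite opprD expRD.
have h1 := sqr_le_expR (mulr_ge0 (ltW s0) y0).
have h2 := expR_ge1Dx (- (q * y ^+ 2)).
have e : expR (- (s / 2 * y)) = expR (- (s * y)) * expR (s * y / 2).
  by rewrite -expRD; congr expR; field.
rewrite e.
have E0 := expR_gt0 (- (s * y)).
apply: (@le_trans _ _ (expR (- (s * y)) * (1 - q * y ^+ 2))); last by rewrite ler_pM2l.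
have -> : expR (- (s * y)) - 8 * q / s ^+ 2 * (expR (- (s * y)) * expR (s * y / 2)) =
  expR (- (s * y)) * (1 - 8 * q / s ^+ 2 * expR (s * y / 2)) by ring.
rewrite ler_pM2l// lerD2l lerN2.
have -> : q * y ^+ 2 = q / s ^+ 2 * (s * y) ^+ 2 by field; rewrite gt_eqF.
have -> : 8 * q / s ^+ 2 * expR (s * y / 2) = q / s ^+ 2 * (8 * expR (s * y / 2)) by ring.
by rewrite ler_wpM2l// divr_ge0// ltW.
Qed.

(** * Lower bound on the grid sum *)

(** Thresholds at most [rho] give
    [1 - x i * y >= exp(- x i * y - 2 * rho * x i * y ^ 2)]; summing over the firms
    leaves the exponent [s * y + 2 * rho * s * y ^ 2] handled by
    [right_mean_quadratic].  The factor [c] in the thresholds of the workers is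
    bounded by [1]. *)
Lemma row_weight_ge (R : realType) (n k N : nat) (c s rho : R) (a : {ffun 'I_n -> 'I_N}) :
  (0 < N)%N -> 0 <= c -> c <= 1 -> 0 < s -> s <= N%:R -> 0 <= rho -> rho <= 2^-1 ->
  64 * rho / s <= 2^-1 ->
  (forall i, c * (a i).+1%:R / N%:R <= rho) ->
  \sum_i (c * (a i).+1%:R / N%:R) <= s ->
  expR (- (k%:R * (s * (1 + 2 * rho)))) * (expR (- (128 * rho / s)) * right_mean N s) ^+ n
  <= row_weight k (fun a => c * a.+1%:R / N%:R) a.
Proof.
move=> N0 c0 c1 s0 sN r0 r1 rs ar as_.
have N0' : 0 < N%:R :> R by rewrite ltr0n.
pose x i : R := c * (a i).+1%:R / N%:R.
have x0 i : 0 <= x i by rewrite /x divr_ge0// mulr_ge0.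
have xr i : x i <= rho by exact: ar.
have x_half i : x i <= 2^-1 by exact: le_trans (xr i) r1.
have xx : \sum_i (x i + 2 * x i ^+ 2) <= s * (1 + 2 * rho).
  apply: (@le_trans _ _ (\sum_i x i * (1 + 2 * rho))).
    apply: ler_sum => i _; have := xr i; have := x0 i; nra.
  by rewrite -mulr_suml ler_wpM2r// addr_ge0// mulr_ge0.
have F0 : 0 <= expR (- (128 * rho / s)) * right_mean N s.
  by apply: mulr_ge0; [exact: expR_ge0 | exact: right_mean_ge0].
apply: ler_pM; rewrite ?expR_ge0 ?(exprn_ge0 _ F0)//.
  apply: (@le_trans _ _ (\prod_i expR (- (x i + 2 * x i ^+ 2)) ^+ k)).
    rewrite prodrXl -expR_sum expR_exprn.
    by rewrite ler_expR sumrN mulrN lerN2 ler_wpM2l.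
  apply: ler_prod => i _; rewrite exprn_ge0 ?expR_ge0//=.
  by rewrite lerXn2r ?nnegrE ?expR_ge0 ?subr_ge0 ?expRN_le_sub1// (le_trans (x_half
    i))//; lra.
rewrite -[X in _ ^+ X](card_ord n) -prodr_const; apply: ler_prod => j _.
rewrite F0 /=.
pose q := 2 * rho * s.
have q0 : 0 <= q by rewrite !mulr_ge0// ltW.
have qs : 32 * q / s ^+ 2 <= 2^-1.
  by rewrite (_ : 32 * q / s ^+ 2 = 64 * rho / s)// /q; field; rewrite gt_eqF.
have := right_mean_quadratic N0 s0 sN q0 qs.
have -> : 64 * q / s ^+ 2 = 128 * rho / s by rewrite /q; field; rewrite gt_eqF.
move=> h; apply: le_trans h _; rewrite ler_wpM2l ?invr_ge0 ?ler0n//.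
apply: ler_sum => b _; set y := b.+1%:R / N%:R.
have [/= y00 y01 y1] := cell_sub01 R (ltn_ord b).
have y0 : 0 <= y by rewrite divr_ge0.
apply: (@le_trans _ _ (\prod_(i | i != j) expR (- (x i * y + 2 * (x i * y) ^+ 2)))).
  rewrite -expR_sum ler_expR sumrN lerN2.
  apply: (@le_trans _ _ (\sum_i (x i * y + 2 * (x i * y) ^+ 2))).
    rewrite [leRHS](bigD1 j)//= lerDr addr_ge0// mulr_ge0// exprn_ge0// mulr_ge0//.
  apply: (@le_trans _ _ (\sum_i x i * (y + 2 * rho * y ^+ 2))).
    apply: ler_sum => i _; have := xr i; have := x0 i => h1 h2.
    have : x i * x i * y ^+ 2 <= x i * rho * y ^+ 2.
      by rewrite ler_wpM2r ?exprn_ge0// ler_wpM2l.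
    by rewrite !expr2; nra.
  rewrite -mulr_suml.
  apply: (@le_trans _ _ (s * (y + 2 * rho * y ^+ 2))); last by rewrite /q le_eqVlt;
    apply/orP; left; apply/eqP; ring.
  by rewrite ler_wpM2r// addr_ge0// mulr_ge0 ?exprn_ge0// mulr_ge0.
apply: ler_prod => i _; rewrite expR_ge0/=.
have xy : x i * y <= 2^-1 by rewrite -[leRHS]mulr1 ler_pM.
apply: le_trans (expRN_le_sub1 (mulr_ge0 (x0 i) y0) xy) _.
by rewrite lerD2l lerN2 ler_wpM2l ?x0// -mulrA ler_piMl.
Qed.

Lemma ffact_ge_exp (A n : nat) : ((A - n) ^ n <= A ^_ n)%N.
Proof.
suff h m : (m <= n)%N -> ((A - n) ^ m <= A ^_ m)%N by exact: h.
elim: m => // m IH mn; rewrite expnSr ffactnSr leq_mul//; first by rewrite IH// ltnW.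
by rewrite leq_sub2l// ltnW.
Qed.

(** A weak form of the Stirling formula, by induction from
    [(1 - 1 / (n + 1)) ^ (n + 1) <= exp(-1)]. *)
Lemma fact_upper (R : realType) (n : nat) : (0 < n)%N ->
  n`!%:R * expR n%:R <= expR 1 * n%:R * n%:R ^+ n :> R.
Proof.
elim: n => // n IH _; have [->|n0] := posnP n.
  by rewrite factS fact0 muln1 mul1r expr1 !mulr1.
have n0' : 0 < n%:R :> R by rewrite ltr0n.
have {}IH := IH n0.
rewrite factS natrM -[in expR _]natr1 expRD.
pose m : R := n.+1%:R; have m0 : 0 < m by rewrite ltr0n.
have h : n%:R ^+ n.+1 * expR 1 <= m ^+ n.+1.
  have h1 : n%:R = m * (1 - m^-1) :> R.
    by rewrite mulrBr mulr1 mulfV ?gt_eqF// /m -natr1 addrK.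
  rewrite h1 exprMn -mulrA -[leRHS]mulr1 ler_wpM2l ?exprn_ge0 ?(ltW m0)//.
  apply: (@le_trans _ _ (expR (- m^-1) ^+ n.+1 * expR 1)).
    rewrite ler_wpM2r ?expR_ge0// lerXn2r ?nnegrE ?expR_ge0 ?expR_ge1Dx//.
    by rewrite subr_ge0 invf_le1// ler1n.
  by rewrite expR_exprn mulrN mulfV ?gt_eqF// -expRD addNr expR0.
have h2 := ler_wpM2l (_ : 0 <= m * expR 1) IH.
apply: (@le_trans _ _ (m * expR 1 * (expR 1 * n%:R * n%:R ^+ n))).
  rewrite (_ : _ * _ * _ = m * expR 1 * (n`!%:R * expR n%:R)); last by rewrite /m; ring.
  by apply: h2; rewrite mulr_ge0 ?expR_ge0 ?ltW.
have h3 := ler_wpM2l (_ : 0 <= m * expR 1) h.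
have -> : m * expR 1 * (expR 1 * n%:R * n%:R ^+ n) = m * expR 1 * (n%:R ^+ n.+1 * expR 1).
  by rewrite exprS; ring.
apply: le_trans (h3 _) _; first by rewrite mulr_ge0 ?expR_ge0 ?ltW.
by rewrite [m * _]mulrC.
Qed.

(** The other half of the Stirling estimate: by induction on [n] from
    [(1 + 1 / m) ^ m <= exp 1], with [m = n + k]. *)
Lemma ffact_expR_ge (R : realType) (n k : nat) : (0 < k)%N ->
  (n + k)%:R ^+ (n + k) <= ((n + k) ^_ n)%:R * k%:R ^+ k * expR n%:R :> R.
Proof.
move=> k0; elim: n => [|n IH]; first by rewrite ffactn0 expR0 mul1r mulr1.
rewrite addSn ffactSS natrM -[in expR _]natr1 expRD.
pose m : R := (n + k)%:R; have m0 : 0 < m by rewrite ltr0n addn_gt0 k0 orbT.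
pose m1 : R := (n + k).+1%:R; have m10 : 0 < m1 by rewrite ltr0n.
have h : m1 ^+ (n + k) <= m ^+ (n + k) * expR 1.
  have -> : m1 = m * (1 + m^-1) by rewrite mulrDr mulr1 mulfV ?gt_eqF// /m1 -natr1.
  rewrite exprMn ler_wpM2l ?exprn_ge0 ?(ltW m0)//.
  apply: le_trans (expr1D_le_expR _ _) _; first by rewrite invr_ge0 ltW.
  by rewrite mulfV ?gt_eqF.
rewrite exprS -!mulrA ler_wpM2l ?(ltW m10)//.
by apply: le_trans h _; rewrite !mulrA ler_wpM2r ?expR_ge0// -mulrA mulrA.
Qed.

(** The most likely number of successes has probability at least [1 / (e * n)],
    uniformly in [k]. *)
Lemma binomial_mode_ge (R : realType) (n k : nat) (t : R) : (0 < n)%N -> (0 < k)%N ->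
  t = k%:R / (n + k)%:R ->
  n`!%:R <= expR 1 * n%:R * (((n + k) ^_ n)%:R * ((1 - t) ^+ n * t ^+ k)).
Proof.
move=> n0 k0 tE; have n0' : 0 < n%:R :> R by rewrite ltr0n.
pose m : R := (n + k)%:R; have m0 : 0 < m by rewrite ltr0n addn_gt0 k0 orbT.
have t1 : 1 - t = n%:R / m.
  by rewrite tE -/m /m natrD; field; rewrite -natrD gt_eqF.
have h1 := ffact_expR_ge R n k0; have h2 := fact_upper R n0.
rewrite -(ler_pM2r (expR_gt0 n%:R)); apply: le_trans h2 _.
rewrite -!mulrA ler_wpM2l ?expR_ge0// ler_wpM2l ?(ltW n0')//.
rewrite t1 tE -/m !expr_div_n.
rewrite [leRHS](_ : _ = n%:R ^+ n * (((n + k) ^_ n)%:R * k%:R ^+ k * expR n%:R / m ^+ (n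
  + k))).
  rewrite ler_peMr ?exprn_ge0 ?(ltW n0')// ler_pdivlMr ?exprn_gt0// mul1r; exact: h1.
rewrite exprD; field.
by rewrite !expf_neq0 ?gt_eqF.
Qed.

(** A given coordinate exceeds [B >= 2 * ln n / n * A] on a proportion at most
    [(1 - B / A) ^ n <= n ^ (-2)] of the simplex, so a union bound leaves at least
    half of it. *)
Lemma card_small_coords_ge (R : realType) (n A B N : nat) : (1 < n)%N -> (n <= A)%N ->
  (B <= N.+1)%N ->
  2 * ln n%:R / n%:R * A%:R <= B%:R :> R ->
  (A - n)%:R ^+ n <= 2 * #|[pred a : {ffun 'I_n -> 'I_N.+1} |
      (\sum_i a i <= A - n)%N & [forall i, (a i < B)%N]]|%:R * n`!%:R :> R.
Proof.
move=> n1 nA BN tB; have n0 : (0 < n)%N by apply: ltnW.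
have n0' : 0 < n%:R :> R by rewrite ltr0n.
set G := #|_|.
have A0' : 0 < A%:R :> R by rewrite ltr0n (leq_trans n0).
have h1 : (A ^_ n <= G * n`! + n * (A - B) ^_ n)%N.
  have := card_simplex_small_coords n (A - n) BN; rewrite subnKC// -/G => h.
  by rewrite -!bin_ffact mulnA -mulnDl leq_mul2r h orbT.
have h2 : n%:R * ((A - B) ^_ n)%:R <= (A ^_ n)%:R / 2 :> R.
  have [BA|AB] := leqP B A; last first.
    by rewrite (eqP (ltnW AB : (A <= B)%N)) ffact0n eqn0Ngt n0 mulr0 divr_ge0.
  have r : ((A - B) ^_ n)%:R <= (A ^_ n)%:R * ((A - B)%:R / A%:R) ^+ n :> R.
    rewrite expr_div_n mulrA ler_pdivlMr ?exprn_gt0// -!natrX -!natrM ler_nat.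
    exact: ffact_sub_ratio.
  have e : ((A - B)%:R / A%:R) ^+ n <= (n%:R ^+ 2)^-1 :> R.
    have -> : (n%:R ^+ 2)^-1 = expR (- (2 * ln n%:R / n%:R)) ^+ n :> R.
      rewrite expR_exprn mulrN (_ : n%:R * _ = 2 * ln n%:R); last by field;
        rewrite gt_eqF.
      by rewrite expRN expRM_natl lnK ?posrE.
    rewrite lerXn2r ?nnegrE ?expR_ge0 ?divr_ge0//.
    apply: le_trans (expR_ge1Dx _); rewrite natrB// mulrBl mulfV ?gt_eqF// lerD2l lerN2.
    by rewrite ler_pdivlMr.
  apply: (@le_trans _ _ (n%:R * ((A ^_ n)%:R * (n%:R ^+ 2)^-1))).
    by rewrite ler_wpM2l ?(ltW n0')// (le_trans r)// ler_wpM2l.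
  rewrite mulrCA ler_wpM2l//.
  have -> : n%:R * (n%:R ^+ 2)^-1 = n%:R^-1 :> R by field; rewrite gt_eqF.
  by rewrite lef_pV2 ?posrE// ler_nat.
have h3 : (A - n)%:R ^+ n <= (A ^_ n)%:R :> R by rewrite -natrX ler_nat ffact_ge_exp.
have h4 : (A ^_ n)%:R <= G%:R * n`!%:R + n%:R * ((A - B) ^_ n)%:R :> R.
  by rewrite -!natrM -natrD ler_nat.
lra.
Qed.

(** The bound on [k * s ^ 2] comes from [s = 2 * ln v] with [v ^ 2 = 1 + n / k]
    and [ln v <= v - 1]. *)
Lemma ln_ratio_facts (R : realType) (n k : nat) (s : R) : (1 < n)%N -> (0 < k)%N ->
  s = ln ((n + k)%:R / k%:R) ->
  [/\ 0 < s, expR (- s) = k%:R / (n + k)%:R, k%:R * s ^+ 2 <= 4 * n%:R & s <=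
    2 * ln n%:R].
Proof.
move=> n1 k0 sE; have n0 : (0 < n)%N by apply: ltnW.
have n0' : 0 < n%:R :> R by rewrite ltr0n.
have k0' : 0 < k%:R :> R by rewrite ltr0n.
have m0 : 0 < (n + k)%:R :> R by rewrite ltr0n addn_gt0 n0.
pose r : R := (n + k)%:R / k%:R.
have rE : r = 1 + n%:R / k%:R by rewrite /r natrD; field; rewrite gt_eqF.
have nk : 0 < n%:R / k%:R :> R by rewrite divr_gt0.
have r1 : 1 < r by rewrite rE ltrDl.
have r0 : 0 < r by rewrite (lt_trans ltr01).
split.
- by rewrite sE ln_gt0.
- by rewrite sE expRN lnK ?posrE// invf_div.
- pose v := Num.sqrt r.
  have v2 : v ^+ 2 = r by rewrite sqr_sqrtr// ltW.
  have v1 : 1 <= v by rewrite -sqrtr1 ler_wsqrtr// ltW.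
  have s2 : s = 2 * ln v.
    by rewrite sE -/r -v2 lnXn ?mulr_natl// (lt_le_trans ltr01).
  have lv : ln v <= v - 1.
    have := @le_ln1Dx R (v - 1); rewrite [1 + _]addrC subrK; apply; lra.
  have lv0 : 0 <= ln v by rewrite ln_ge0.
  have : ln v ^+ 2 <= n%:R / k%:R.
    have : ln v ^+ 2 <= (v - 1) ^+ 2 by rewrite lerXn2r ?nnegrE// subr_ge0.
    by move: v2; rewrite rE !expr2; nra.
  rewrite ler_pdivlMr// s2 exprMn => h; nra.
- rewrite sE.
  have -> : 2 * ln n%:R = ln (n%:R ^+ 2) :> R by rewrite lnXn// mulr_natl.
  rewrite ler_ln ?posrE ?exprn_gt0// -/r rE.
  have : n%:R / k%:R <= n%:R :> R.
    by rewrite ler_pdivrMr// ler_peMr ?(ltW n0')// ler1n.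
  have : 2 <= n%:R :> R by rewrite ler_nat.
  rewrite expr2; nra.
Qed.

Lemma grid_sum_ge_card (R : realType) (n k N : nat) (u : nat -> R) (w : R)
    (Q : pred {ffun 'I_n -> 'I_N}) :
  (forall a, (a < N)%N -> 0 <= u a <= 1) ->
  (forall a : {ffun 'I_n -> 'I_N}, Q a -> w <= row_weight k u a) ->
  N%:R ^- n * (#|Q|%:R * w) <= grid_sum n k N u.
Proof.
move=> u01 Qw; rewrite grid_sumE ler_wpM2l ?invr_ge0 ?exprn_ge0//.
rewrite mulr_natl -sumr_const [leRHS](bigID Q)/= -[leLHS]addr0 lerD//.
  by apply: ler_sum => a; exact: Qw.
by apply: sumr_ge0 => a _; exact: row_weight_ge0.
Qed.

(** As [A] grows, [N] is chosen of order [c * A / s] and [B] of order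
    [A * tau]: the lattice simplex of size [A] becomes the simplex of sum [s], and
    [A] large makes all rounding errors harmless. *)
Lemma lower_grid_parameters (R : realType) (n : nat) (c s tau : R) :
  (1 < n)%N -> 0 < s -> 0 < tau -> tau * s <= 4^-1 -> 2^-1 <= c -> c <= 1 ->
  exists A N B : nat,
    [/\ (n <= A)%N, (B <= N.+1)%N, A%:R * tau <= B%:R & B%:R <= 2 * (A%:R * tau)] /\
    [/\ c * A%:R / N.+1%:R <= s, s * n%:R <= N.+1%:R &
        s / c * (1 - n%:R^-1) * N.+1%:R <= (A - n)%:R].
Proof.
move=> n1 s0 tau0 tau_s c2 c1.
have n2 : 2 <= n%:R :> R by rewrite ler_nat.
have n0' : 0 < n%:R :> R by lra.
have c0 : 0 < c by lra.
have tV0 : 0 < tau^-1 by rewrite invr_gt0.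
have sn0 : 0 < s * n%:R by rewrite mulr_gt0.
have ssn0 : 0 < s * s * n%:R by rewrite !mulr_gt0.
have nn0 : 0 < n%:R * n%:R :> R by rewrite mulr_gt0.
(* one summand for each requirement that [A] be large *)
pose rA := n%:R * n%:R + 2 * (s * n%:R) + tau^-1 + 2 * (s * s * n%:R).
have rA0 : 0 <= rA by rewrite /rA; lra.
have /andP[_ /ltW hA] := truncn_itv rA0.
have A0 : 0 < (Num.truncn rA).+1%:R :> R by rewrite ltr0n.
move: (Num.truncn rA).+1 A0 hA => A A0 hA.
have hA1 : n%:R * n%:R + 2 * (s * n%:R) <= A%:R by move: hA; rewrite /rA; lra.
have hA2 : tau^-1 <= A%:R by move: hA; rewrite /rA; lra.
have hA3 : 2 * (s * s * n%:R) <= A%:R by move: hA; rewrite /rA; lra.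
clear rA rA0 hA.
have At1 : 1 <= A%:R * tau by rewrite -ler_pdivrMr// div1r.
have nA : (n <= A)%N by rewrite -(ler_nat R); clear hA2 hA3 At1; nra.
pose rN := c * A%:R / s.
have rN0 : 0 <= rN by rewrite divr_ge0 ?(ltW s0)// mulr_ge0 ?(ltW c0).
have /andP[hN1 hN2] := truncn_itv rN0.
move: (Num.truncn rN) hN1 hN2 => N hN1 hN2.
have At0 : 0 <= A%:R * tau by lra.
have /andP[hB1 /ltW hB2] := truncn_itv At0.
move: (Num.truncn (A%:R * tau)) hB1 hB2 => B' hB1 hB2.
have hB3 : B'.+1%:R <= 2 * (A%:R * tau) by rewrite -natr1; lra.
have N0 : 0 < N.+1%:R :> R by rewrite ltr0n.
exists A, N, B'.+1; split; split => //.
- rewrite -(ler_nat R) (le_trans hB3)// (le_trans _ (ltW hN2))// /rN ler_pdivlMr//.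
  have h1 : A%:R * (tau * s) <= A%:R * 4^-1 by rewrite ler_wpM2l.
  have h2 : 2^-1 * A%:R <= c * A%:R by rewrite ler_wpM2r.
  by rewrite (_ : 2 * (A%:R * tau) * s = 2 * (A%:R * (tau * s))); [lra|ring].
- by rewrite ler_pdivrMr// [leRHS]mulrC -ler_pdivrMr// ltW.
- apply: le_trans (ltW hN2); rewrite /rN ler_pdivlMr//.
  have h2 : 2^-1 * A%:R <= c * A%:R by rewrite ler_wpM2r.
  by rewrite (_ : s * n%:R * s = s * s * n%:R); [lra|ring].
have nV : 0 <= 1 - n%:R^-1 :> R by rewrite subr_ge0 invf_le1// ler1n ltnW.
have h1 : s / c * N.+1%:R <= A%:R + 2 * s.
  apply: (@le_trans _ _ (s / c * (rN + 1))).
    by rewrite ler_wpM2l ?divr_ge0 ?(ltW s0) ?(ltW c0)// -natr1 lerD2r.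
  have -> : s / c * (rN + 1) = A%:R + s / c.
    by rewrite /rN; field; rewrite (gt_eqF s0) (gt_eqF c0).
  rewrite lerD2l ler_pdivrMr// mulrAC -[leLHS]mul1r ler_wpM2r ?(ltW s0)//.
  by clear -c2; lra.
rewrite mulrAC natrB//; apply: le_trans (ler_wpM2r nV h1) _.
have h2 : n%:R + 2 * s <= A%:R / n%:R.
  by rewrite ler_pdivlMr// mulrDl -mulrA.
have h3 : 0 <= 2 * s / n%:R by rewrite divr_ge0 ?(ltW n0')// mulr_ge0 ?(ltW s0).
have -> : (A%:R + 2 * s) * (1 - n%:R^-1) = A%:R + 2 * s - A%:R / n%:R - 2 * s / n%:R by
  ring.
by clear -h2 h3; lra.
Qed.

Lemma expRN2_le (R : realType) (n : nat) : (1 < n)%N -> expR (- 2) <=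
  (1 - n%:R^-1) ^+ n :> R.
Proof.
move=> n1; have n0' : 0 < n%:R :> R by rewrite ltr0n ltnW.
have nV2 : n%:R^-1 <= 2^-1 :> R by rewrite lef_pV2 ?posrE// ler_nat.
have nV0 : 0 <= n%:R^-1 :> R by rewrite invr_ge0.
apply: (@le_trans _ _ (expR (- (n%:R^-1 + 2 * n%:R^-1 ^+ 2)) ^+ n)).
  rewrite expR_exprn ler_expR mulrN lerN2 mulrDr mulfV ?gt_eqF//.
  have -> : n%:R * (2 * n%:R^-1 ^+ 2) = 2 * n%:R^-1 :> R by field; rewrite gt_eqF.
  lra.
by rewrite lerXn2r ?nnegrE ?expR_ge0 ?expRN_le_sub1// subr_ge0; lra.
Qed.

(** The proportion of good cells is [s ^ n / (c ^ n * n!)] up to a constant;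
    the factor [c ^ (- n)] is the gain that makes the expectation large. *)
Lemma simplex_density_ge (R : realType) (n : nat) (s c N x G f : R) :
  (1 < n)%N -> 0 < s -> 0 < c -> 0 < N -> 0 < f -> 0 <= x ->
  s / c * (1 - n%:R^-1) * N <= x -> x ^+ n <= 2 * G * f ->
  c ^- n * expR (- 2) / (2 * f) <= N ^- n * G * s ^- n.
Proof.
move=> n1 s0 c0 N0 f0 x0 hx hG; rewrite ler_pdivrMr ?mulr_gt0//.
have nV : 0 <= 1 - n%:R^-1 :> R by rewrite subr_ge0 invf_le1 ?ltr0n ?ler1n// ltnW.
have h : (s / c * (1 - n%:R^-1) * N) ^+ n <= 2 * G * f.
  apply: le_trans hG; rewrite lerXn2r ?nnegrE//.
  by rewrite mulr_ge0 ?(ltW N0)// mulr_ge0// divr_ge0 ?(ltW s0) ?(ltW c0).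
rewrite !exprMn exprVn in h.
have sc0 : 0 <= s ^+ n * c ^- n by rewrite mulr_ge0 ?invr_ge0 ?exprn_ge0 ?(ltW s0)
  ?(ltW c0).
have h' : s ^+ n * c ^- n * expR (- 2) * N ^+ n <= 2 * G * f.
  apply: le_trans h; rewrite ler_wpM2r ?exprn_ge0 ?(ltW N0)// ler_wpM2l//.
  exact: expRN2_le.
have sNn : 0 < s ^- n * N ^- n by rewrite mulr_gt0 ?invr_gt0 ?exprn_gt0.
have := ler_wpM2l (ltW sNn) h'.
have -> : s ^- n * N ^- n * (s ^+ n * c ^- n * expR (- 2) * N ^+ n) = c ^- n * expR (- 2).
  by field; rewrite !expf_neq0 ?gt_eqF.
have -> : s ^- n * N ^- n * (2 * G * f) = N ^- n * G * s ^- n * (2 * f) by ring.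
by [].
Qed.

(** The lower bound of [row_weight_ge], as a function of the largest allowed
    threshold [rho] and the sum [s]. *)
Definition row_bound (R : realType) (n k N : nat) (s rho : R) : R :=
  expR (- (k%:R * (s * (1 + 2 * rho)))) * (expR (- (128 * rho / s)) * right_mean N s)
    ^+ n.

Lemma row_bound_ge (R : realType) (n k N : nat) (s rho t a b : R) :
  (0 < N)%N -> 0 < s -> expR (- s) = t -> t <= 1 -> s * n%:R <= N%:R ->
  2 * (k%:R * s * rho) <= a -> 128 * n%:R * rho / s <= b ->
  (t ^+ k * expR (- (a + b + 1))) * ((1 - t) ^+ n * s ^- n) <= row_bound n k N s rho.
Proof.
move=> N0 s0 et t1 sN ha hb.
have N0' : 0 < N%:R :> R by rewrite ltr0n.
have t0 : 0 <= t by rewrite -et expR_ge0.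
have ps0 : 0 <= (1 - t) ^+ n * s ^- n.
  by rewrite mulr_ge0 ?invr_ge0 ?exprn_ge0 ?subr_ge0 ?(ltW s0).
have -> : (t ^+ k * expR (- (a + b + 1))) * ((1 - t) ^+ n * s ^- n) =
    (t ^+ k * expR (- a)) * (expR (- b) * (expR (- 1) * ((1 - t) ^+ n * s ^- n))).
  have -> : - (a + b + 1) = (- a) + (- b) + (- 1) by ring.
  by rewrite !expRD; ring.
apply: ler_pM.
- by rewrite mulr_ge0 ?exprn_ge0 ?expR_ge0.
- by rewrite !mulr_ge0 ?expR_ge0 ?invr_ge0 ?exprn_ge0 ?subr_ge0 ?(ltW s0).
- rewrite -et expR_exprn -expRD ler_expR.
  have -> : - (k%:R * (s * (1 + 2 * rho))) = k%:R * - s - 2 * (k%:R * s * rho) by ring.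
  by rewrite lerD2l lerN2.
rewrite exprMn; apply: ler_pM.
- exact: expR_ge0.
- by rewrite mulr_ge0 ?expR_ge0.
- rewrite expR_exprn ler_expR mulrN lerN2.
  by rewrite (_ : n%:R * (128 * rho / s) = 128 * n%:R * rho / s)//; ring.
have h := right_mean_ge N0 s0; rewrite et in h.
apply: (@le_trans _ _ ((expR (- (s / N%:R)) * ((1 - t) / s)) ^+ n)); last first.
  by rewrite lerXn2r ?nnegrE ?right_mean_ge0// mulr_ge0 ?expR_ge0// divr_ge0 ?subr_ge0//
    ltW.
rewrite exprMn expr_div_n expR_exprn ler_wpM2r//.
by rewrite ler_expR mulrN lerN2 mulrA ler_pdivrMr// mul1r mulrC.
Qed.

(** The factorials and the powers of [s] cancel between the binomial
    probability, the density of good cells and the weight of a row; the remaining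
    constants and factors [n] are absorbed in [exp(- 8 * L) = n ^ (- 8)]. *)
Lemma combine_lower_estimates (R : realType) (n : nat) (f F p tk g w s c a L : R) :
  0 < f -> 0 <= F -> 0 <= p -> 0 <= tk -> 0 <= g -> 0 < s -> 0 < c ->
  1 <= L -> (1 < n)%N -> n%:R = expR L ->
  f <= expR 1 * n%:R * (n.+1%:R * (F * (p * tk))) ->
  c ^- n * expR (- 2) / (2 * f) <= g * s ^- n ->
  (tk * expR (- (a + 1))) * (p * s ^- n) <= w ->
  c ^- n * expR (- (a + 8 * L)) <= F * (g * w).
Proof.
move=> f0 F0 p0 tk0 g0 s0 c0 L1 n1 nL hF hg hw.
have n0' : 0 < n%:R :> R by rewrite nL expR_gt0.
have n0'' : 0 < n.+1%:R :> R by rewrite ltr0n.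
pose e1 := expR (- (a + 1)); have e10 : 0 <= e1 by exact: expR_ge0.
apply: le_trans (ler_wpM2l F0 (ler_wpM2l g0 hw)).
rewrite [leRHS](_ : _ = F * (p * tk) * (g * s ^- n) * e1); last by rewrite /e1; ring.
pose D : R := expR 1 * n%:R * n.+1%:R.
have D0 : 0 < D by rewrite !mulr_gt0 ?expR_gt0.
have hF' : f / D <= F * (p * tk).
  by rewrite ler_pdivrMr// (le_trans hF)// le_eqVlt; apply/orP; left; apply/eqP;
    rewrite /D; ring.
apply: (@le_trans _ _ (f / D * (c ^- n * expR (- 2) / (2 * f)) * e1)); last first.
  apply: ler_wpM2r e10 _ _ _; apply: ler_pM hF' hg.
    by rewrite divr_ge0 ?(ltW f0) ?(ltW D0).
  by rewrite divr_ge0 ?mulr_ge0 ?invr_ge0 ?exprn_ge0 ?expR_ge0 ?(ltW c0) ?(ltW f0).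
have -> : f / D * (c ^- n * expR (- 2) / (2 * f))
  * e1 = c ^- n * ((D * 2)^-1 * (expR (- 2) * e1)).
  by field; rewrite ?expf_neq0 ?gt_eqF.
rewrite ler_wpM2l ?invr_ge0 ?exprn_ge0 ?(ltW c0)//.
have hD : D * 2 <= expR (5 * L).
  have -> : expR (5 * L) = expR L * n%:R * n%:R ^+ 2 * n%:R.
    by rewrite nL -expR_exprn expr2 -!expRD expR_exprn; congr expR; ring.
  have h1 : 2 <= n%:R :> R by rewrite ler_nat.
  have h2 : n.+1%:R <= n%:R ^+ 2 :> R by rewrite -natrX ler_nat -mulnn ltn_Pmulr// ltnW.
  have h3 : expR 1 * n%:R <= expR L * n%:R by rewrite ler_wpM2r ?(ltW n0')// ler_expR.
  have h4 : 0 <= expR 1 * n%:R :> R by rewrite mulr_ge0 ?expR_ge0 ?(ltW n0').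
  exact: ler_pM (ltW D0) (ler0n _ 2) (ler_pM h4 (ltW n0'') h3 h2) h1.
have D20 : 0 < D * 2 by rewrite mulr_gt0.
apply: (@le_trans _ _ ((expR (5 * L))^-1 * (expR (- 2) * e1))); last first.
  by rewrite ler_wpM2r ?mulr_ge0 ?expR_ge0// lef_pV2 ?posrE ?expR_gt0.
by rewrite -expRN /e1 -!expRD ler_expR; lra.
Qed.

(** For [k = 0] the mode [s = ln(1 + n / k)] is infinite, so [k] is replaced
    by [max(k, 1)]: the weights can only decrease, and the number of matchings
    changes by a factor at most [n + 1]. *)
Lemma grid_sum_ge_poly (R : realType) (n k : nat) (c : R) (L := ln n%:R : R) :
  1 <= L -> 512 * L <= n%:R -> 16 * L ^+ 2 <= n%:R -> 2^-1 <= c -> c <= 1 ->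
  exists N, c ^- n * expR (- (552 * L)) <=
  ((n + k) ^_ n)%:R * grid_sum n k N (fun a => c * a.+1%:R / N%:R).
Proof.
move=> L1 L512 L16 c2 c1.
have n512 : 512 <= n%:R :> R by lra.
have n1 : (1 < n)%N by rewrite -(ltr_nat R); lra.
have n0 : (0 < n)%N by apply: ltnW.
have n0' : 0 < n%:R :> R by rewrite ltr0n.
have c0 : 0 < c by lra.
pose kap := maxn k 1.
have kap0 : (0 < kap)%N by rewrite /kap leq_max orbT.
pose s : R := ln ((n + kap)%:R / kap%:R).
have [s0 es kss sL] := ln_ratio_facts n1 kap0 (erefl s).
pose t : R := kap%:R / (n + kap)%:R; rewrite -/t in es.
have t0 : 0 <= t by rewrite -es expR_ge0.
have t1 : t <= 1 by rewrite -es expR_le1 oppr_le0 ltW.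
(* [(1 - tau) ^ n <= n ^ (- 2)], which a union bound over [n] coordinates affords *)
pose tau := 2 * L / n%:R.
have tau0 : 0 < tau by rewrite divr_gt0//; lra.
have tau_s : tau * s <= 4^-1.
  rewrite /tau mulrAC ler_pdivrMr//.
  have h : 2 * L * s <= 2 * L * (2 * L) by rewrite ler_wpM2l//; lra.
  by move: L16; rewrite expr2; lra.
have tau2 : 256 * tau <= 1 by rewrite /tau mulrA ler_pdivrMr//; lra.
have [A [N [B [[nA BN hB2 hB3] [cAN sN hAN]]]]] :=
  lower_grid_parameters n1 s0 tau0 tau_s c2 c1.
clear L512 L16 n512.
pose rho := 2 * tau * s.
have rho0 : 0 <= rho by exact: mulr_ge0 (mulr_ge0 (ler0n _ 2) (ltW tau0)) (ltW s0).
pose Q := [pred a : {ffun 'I_n -> 'I_N.+1} | (\sum_i a i <=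
  A - n)%N & [forall i, (a i < B)%N]].
have hcount : (A - n)%:R ^+ n <= 2 * #|Q|%:R * n`!%:R :> R.
  by apply: card_small_coords_ge => //; rewrite mulrC.
have N0 : 0 < N.+1%:R :> R by rewrite ltr0n.
have hw (a : {ffun 'I_n -> 'I_N.+1}) : Q a ->
    row_bound n kap N.+1 s rho <= row_weight k (fun a => c * a.+1%:R / N.+1%:R) a.
  move=> /andP[aA /forallP aB].
  have h1 : s <= N.+1%:R.
    by apply: le_trans sN; rewrite ler_peMr ?(ltW s0)// ler1n.
  have h2 : rho <= 2^-1 by rewrite /rho -mulrA; clear -tau_s; lra.
  have h3 : 64 * rho / s <= 2^-1.
    rewrite /rho (_ : 64 * _ / s = 128 * tau); first by clear -tau2; lra.
    by field; rewrite (gt_eqF s0).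
  have h4 i : c * (a i).+1%:R / N.+1%:R <= rho.
    apply: (@le_trans _ _ (c * B%:R / N.+1%:R)).
      by rewrite ler_wpM2r ?invr_ge0 ?(ltW N0)// ler_wpM2l ?(ltW c0)// ler_nat; exact: aB.
    apply: (@le_trans _ _ (c * A%:R / N.+1%:R * (2 * tau))).
      have -> : c * A%:R / N.+1%:R * (2 * tau) = c * (2 * (A%:R * tau)) / N.+1%:R by ring.
      by rewrite ler_wpM2r ?invr_ge0 ?(ltW N0)// ler_wpM2l ?(ltW c0).
    by rewrite /rho mulrC ler_wpM2l// mulr_ge0 ?(ltW tau0).
  have h5 : \sum_i (c * (a i).+1%:R / N.+1%:R) <= s.
    apply: le_trans cAN; rewrite -mulr_suml -mulr_sumr -natr_sum.
    rewrite ler_wpM2r ?invr_ge0 ?(ltW N0)// ler_wpM2l ?(ltW c0)// ler_nat.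
    under eq_bigr do rewrite -addn1.
    by rewrite big_split/= sum1_card card_ord addnC -leq_subRL.
  apply: le_trans (row_weight_ge k (ltn0Sn N) (ltW c0) c1 s0 h1 rho0 h2 h3 h4 h5).
  rewrite ler_wpM2r//.
    by rewrite exprn_ge0// mulr_ge0 ?expR_ge0// right_mean_ge0.
  rewrite ler_expR lerN2 ler_wpM2r ?ler_nat ?leq_maxl//.
  by rewrite mulr_ge0 ?(ltW s0)// addr_ge0// mulr_ge0.
exists N.+1.
have u01 a : (a < N.+1)%N -> 0 <= c * a.+1%:R / N.+1%:R <= 1.
  move=> aN; have [_ h1 h2] := cell_sub01 R aN.
  by rewrite -mulrA mulr_ge0 ?(ltW c0)//= mulr_ile1 ?(ltW c0).
apply: le_trans (ler_wpM2l (ler0n _ _) (grid_sum_ge_card u01 hw)).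
have f0 : 0 < n`!%:R :> R by rewrite ltr0n fact_gt0.
have hg := simplex_density_ge n1 s0 c0 N0 f0 (ler0n _ _) hAN hcount.
have ha : 2 * (kap%:R * s * rho) <= 32 * L.
  have -> : 2 * (kap%:R * s * rho) = kap%:R * s ^+ 2 * (8 * L) / n%:R.
    by rewrite /rho /tau; ring.
  rewrite ler_pdivrMr//.
  have L8 : 0 <= 8 * L by clear -L1; lra.
  have := ler_wpM2r L8 kss; clear; lra.
have hb : 128 * n%:R * rho / s <= 512 * L.
  rewrite le_eqVlt; apply/orP; left; apply/eqP.
  by rewrite /rho /tau; field; rewrite (gt_eqF s0) (gt_eqF n0').
have hrow := row_bound_ge (ltn0Sn N) s0 es t1 sN ha hb.
(* [k = 0] against [max(k, 1) = 1] accounts for the factor [n + 1] *)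
have hF : n`!%:R <= expR 1 * n%:R * (n.+1%:R * (((n + k) ^_ n)%:R * ((1 - t)
  ^+ n * t ^+ kap))).
  apply: le_trans (binomial_mode_ge n0 kap0 (erefl t)) _.
  rewrite ler_wpM2l ?mulr_ge0 ?expR_ge0// [leRHS]mulrA ler_wpM2r ?mulr_ge0 ?exprn_ge0
    ?subr_ge0//.
  rewrite -natrM ler_nat /kap; case: (posnP k) => [->|k0].
    by rewrite max0n addn0 addn1 -ffactSS ffactnSr subSnn muln1.
  by rewrite (maxn_idPl k0) leq_pmull.
have nL : n%:R = expR L :> R by rewrite lnK ?posrE.
have -> : 552 * L = 32 * L + 512 * L + 8 * L by ring.
rewrite [X in _ <= _ * X]mulrA.
apply: (combine_lower_estimates f0 _ _ _ _ s0 c0 L1 n1 nL hF hg hrow).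
- exact: ler0n.
- by rewrite exprn_ge0// subr_ge0.
- exact: exprn_ge0.
- by rewrite mulr_ge0 ?ler0n// invr_ge0 exprn_ge0// ltW.
Qed.

(** * Polynomial and super-polynomial regimes *)

(** From [ln q <= q] with [q] the fourth root of [n]. *)
Lemma ln_le_root4 (R : realType) (n M : nat) : (0 < M)%N -> (M ^ 4 <= n)%N ->
  M%:R ^+ 3 * ln n%:R <= 4 * n%:R :> R /\ M%:R ^+ 2 * ln n%:R ^+ 2 <= 16 * n%:R :> R.
Proof.
move=> M0 Mn; have n0 : (0 < n)%N by apply: leq_trans Mn; rewrite expn_gt0 M0.
have M0' : 0 <= M%:R :> R by [].
pose q : R := Num.sqrt (Num.sqrt n%:R).
have q4 : q ^+ 4 = n%:R.
  by rewrite (exprM q 2 2) !sqr_sqrtr// sqrtr_ge0.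
have q0 : 0 < q by rewrite !sqrtr_gt0 ltr0n.
have Mq : M%:R <= q.
  by rewrite -(ler_pXn2r (n := 4)) ?nnegrE// ?(ltW q0)// q4 -natrX ler_nat.
have Lq : ln n%:R <= 4 * q.
  rewrite -q4 lnXn// -[ln q *+ 4]mulr_natl ler_wpM2l//; exact: ltW (ln_sublinear q0).
have L0 : 0 <= ln n%:R :> R by rewrite ln_ge0// ler1n.
split.
  rewrite -[in leRHS]q4 (_ : 4 * q ^+ 4 = q ^+ 3 * (4 * q)); last by ring.
  have Mq3 : M%:R ^+ 3 <= q ^+ 3 by rewrite lerXn2r ?nnegrE// ltW.
  exact: ler_pM (exprn_ge0 _ M0') L0 Mq3 Lq.
rewrite -[in leRHS]q4 (_ : 16 * q ^+ 4 = q ^+ 2 * (4 * q) ^+ 2); last by ring.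
have q40 : 0 <= 4 * q by rewrite mulr_ge0// ltW.
have Mq2 : M%:R ^+ 2 <= q ^+ 2 by rewrite lerXn2r ?nnegrE// ltW.
have Lq2 : ln n%:R ^+ 2 <= (4 * q) ^+ 2 by rewrite lerXn2r ?nnegrE.
exact: ler_pM (exprn_ge0 _ M0') (exprn_ge0 _ L0) Mq2 Lq2.
Qed.

Lemma ln_nat_ge1 (R : realType) (n : nat) : (4 <= n)%N -> 1 <= ln n%:R :> R.
Proof.
move=> n4; have n0 : 0 < n%:R :> R by rewrite ltr0n (leq_trans _ n4).
rewrite -(ler_expR) lnK ?posrE//; apply: (@le_trans _ _ 4); last by rewrite ler_nat.
have h : 2^-1 <= expR (- 2^-1) :> R by apply: le_trans (expR_ge1Dx _); lra.
have h2 : expR (2^-1) <= 2 :> R.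
  by move: h; rewrite expRN lef_pV2 ?posrE ?expR_gt0.
have -> : expR 1 = expR (2^-1) * expR (2^-1) :> R by rewrite -expRD; congr expR; lra.
have := expR_gt0 (2^-1 : R); nra.
Qed.

Lemma powR_natE (R : realType) (n : nat) (K : R) : (0 < n)%N ->
  n%:R `^ K = expR (K * ln n%:R).
Proof. by move=> n0; rewrite /powR pnatr_eq0 gtn_eqF. Qed.

Lemma expected_le_powR (R : realType) (n k : nat) (lam eps C : R)
  (d : measure_display) (T : measurableType d) (P : probability T R)
  (X Y : 'I_n -> 'I_(n + k) -> {RV P >-> R}) :
  0 < lam -> 0 < eps -> (5 <= n)%N -> eps * lam <= C * (n%:R^-1 * ln n%:R) ->
  random_market X Y ->
  (expected_nb_eps_stable lam eps X Y <= (n%:R `^ (10 + 2 * C))%:E)%E.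
Proof.
move=> l0 e0 n5 h rm; have n0 : (0 < n)%N by apply: leq_trans n5.
have n0' : 0 < n%:R :> R by rewrite ltr0n.
pose c := expR (- (eps * lam)).
have c0 : 0 < c by exact: expR_gt0.
have c1 : c <= 1 by rewrite expR_le1 oppr_le0 mulr_ge0 ?ltW.
have [N N0 hN] := grid_sum_le_poly k n0 c0 c1.
apply: le_trans (expected_le_grid_sum rm N0 l0 e0 (erefl c)) _.
rewrite lee_fin; apply: le_trans hN _; rewrite powR_natE//.
set L := ln n%:R in h *.
have L1 : 1 <= L by apply: ln_nat_ge1; apply: leq_trans n5.
have nL : n%:R = expR L :> R by rewrite lnK ?posrE.
have hc : c ^- (2 * n) <= expR (2 * C * L).
  rewrite -exprVn /c -expRN opprK expR_exprn ler_expR.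
  have := ler_wpM2l (ltW n0') h; rewrite (_ : n%:R * (C * _) = C * L); last by field;
    rewrite gt_eqF.
  by rewrite natrM; lra.
apply: (@le_trans _ _ (expR (4 * L) * expR (2 * C * L) * expR (6 * L))).
  apply: ler_pM; rewrite ?mulr_ge0 ?expR_ge0 ?invr_ge0 ?exprn_ge0 ?(ltW c0)//.
    apply: ler_pM; rewrite ?expR_ge0 ?invr_ge0 ?exprn_ge0 ?(ltW c0)//.
    by rewrite ler_expR ler_peMr.
  apply: (@le_trans _ _ (n%:R ^+ 6)).
    by rewrite -natrX ler_nat expnS leq_mul2r n5 orbT.
  by rewrite nL expR_exprn.
by rewrite -!expRD ler_expR le_eqVlt; apply/orP; left; apply/eqP; ring.
Qed.

(** The value [c = n ^ (- A / n)] with [A = K + 552] gains [n ^ A] in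
    [grid_sum_ge_poly], which loses [n ^ 552]. *)
Lemma expected_ge_powR (R : realType) (n k M : nat) (lam eps K : R)
  (d : measure_display) (T : measurableType d) (P : probability T R)
  (X Y : 'I_n -> 'I_(n + k) -> {RV P >-> R}) :
  0 < lam -> 0 < eps -> 0 < K -> (16 <= M)%N -> 8 * (K + 552) <= M%:R -> (M ^ 4 <= n)%N ->
  K + 552 <= eps * lam * n%:R / ln n%:R ->
  random_market X Y ->
  ((n%:R `^ K)%:E <= expected_nb_eps_stable lam eps X Y)%E.
Proof.
move=> l0 e0 K0 M16 MK Mn h rm.
have M0 : (0 < M)%N by apply: leq_trans M16.
have n4 : (4 <= n)%N.
  by apply: leq_trans Mn; rewrite (leq_trans _ (leq_pexp2l M0 (isT : (1 <=
    4)%N)))// expn1 (leq_trans _ M16).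
have n0 : (0 < n)%N by apply: leq_trans n4.
have n0' : 0 < n%:R :> R by rewrite ltr0n.
have [hL1 hL2] := ln_le_root4 R M0 Mn.
have L1 := ln_nat_ge1 R n4.
set L := ln n%:R in h L1 hL1 hL2.
have M16' : 16 <= M%:R :> R by rewrite ler_nat.
have M3 : M%:R <= M%:R ^+ 3 :> R.
  by rewrite -natrX ler_nat -{1}(expn1 M) leq_pexp2l.
have M2 : 256 <= M%:R ^+ 2 :> R by rewrite expr2; nra.
have M3' : 4096 <= M%:R ^+ 3 :> R by rewrite exprS; nra.
have L0 : 0 <= L by exact: le_trans ler01 L1.
have L512 : 512 * L <= n%:R.
  by have := le_trans (ler_wpM2r L0 M3') hL1; clear -L0; lra.
have L16 : 16 * L ^+ 2 <= n%:R.
  by have := le_trans (ler_wpM2r (exprn_ge0 2 L0) M2) hL2; clear; lra.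
pose A := K + 552; rewrite -/A in MK h.
pose c := expR (- (A * L / n%:R)).
have A0 : 0 < A by rewrite /A; clear -K0; lra.
have AL : A * L / n%:R <= 2^-1.
  rewrite ler_pdivrMr//.
  by have := le_trans (ler_wpM2r L0 (le_trans MK M3)) hL1; clear; lra.
clear hL1 hL2 M3' M2 M3 MK.
have c2 : 2^-1 <= c by apply: le_trans (expR_ge1Dx _); clear -AL; lra.
have c1 : c <= 1 by rewrite expR_le1 oppr_le0 divr_ge0// mulr_ge0// ltW.
have ce : expR (- (eps * lam)) <= c.
  rewrite ler_expR lerN2 ler_pdivrMr//.
  by move: h; rewrite ler_pdivlMr// (lt_le_trans ltr01 L1).
have [N hN] := grid_sum_ge_poly k L1 L512 L16 c2 c1.
apply: le_trans (expected_ge_grid_sum N rm l0 e0 ce c1).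
rewrite lee_fin; apply: le_trans hN; rewrite powR_natE// -/L.
rewrite -exprVn /c -expRN opprK expR_exprn -expRD ler_expR.
have -> : n%:R * (A * L / n%:R) = A * L by field; rewrite gt_eqF.
by rewrite /A le_eqVlt; apply/orP; left; apply/eqP; ring.
Qed.

Theorem theorem1p1 (R : realType) (eps lam : nat -> R)
    (eps_gt0 : forall n : nat, (0 < n)%N -> 0 < eps n)
    (lam_gt0 : forall n : nat, (0 < n)%N -> 0 < lam n) :
  ((fun n : nat => eps n * lam n : R^o) =O_\oo
     (fun n : nat => n%:R^-1 * ln n%:R : R^o) ->
   exists K : R, 0 < K /\ exists n0 : nat,
     forall n k : nat, (0 < n)%N -> (n0 <= n)%N ->
     forall (d : measure_display) (T : measurableType d) (P : probability T R)
       (X Y : 'I_n -> 'I_(n + k) -> {RV P >-> R}),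
       random_market X Y ->
       (expected_nb_eps_stable (lam n) (eps n) X Y <= (n%:R `^ K)%:E)%E)
  /\
  (eps n * lam n * n%:R / ln n%:R @[n --> \oo] --> +oo ->
   forall K : R, 0 < K -> exists n0 : nat,
     forall n k : nat, (0 < n)%N -> (n0 <= n)%N ->
     forall (d : measure_display) (T : measurableType d) (P : probability T R)
       (X Y : 'I_n -> 'I_(n + k) -> {RV P >-> R}),
       random_market X Y ->
       ((n%:R `^ K)%:E <= expected_nb_eps_stable (lam n) (eps n) X Y)%E).
Proof.
split.
  move=> /eqO_exP[C [C0 hC]].
  have [n1 _ hn1] := hC.
  exists (10 + 2 * C); split; first by rewrite addr_gt0// mulr_gt0.
  exists (maxn 5 n1) => n k n0; rewrite geq_max => /andP[n5 nn1] d T P X Y rm.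
  apply: expected_le_powR => //; [exact: lam_gt0|exact: eps_gt0|].
  have el0 : 0 <= eps n * lam n by apply/ltW/mulr_gt0; [exact: eps_gt0 | exact: lam_gt0].
  have ln0' : 0 <= n%:R^-1 * ln n%:R :> R by rewrite mulr_ge0 ?invr_ge0// ln_ge0// ler1n.
  by have := hn1 n nn1; rewrite /= !ger0_norm.
move=> /cvgryPge hcv K K0.
have [n1 _ hn1] := hcv (K + 552).
have A0 : 0 <= 8 * (K + 552) by lra.
pose M := maxn 16 (Num.truncn (8 * (K + 552))).+1.
exists (maxn (M ^ 4) n1) => n k n0; rewrite geq_max => /andP[nM nn1] d T P X Y rm.
apply: (@expected_ge_powR R n k M) => //.
- exact: lam_gt0.
- exact: eps_gt0.
- by rewrite /M leq_maxl.
- have /andP[_ /ltW h] := truncn_itv A0.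
  by apply: le_trans h _; rewrite ler_nat leq_maxr.
- exact: hn1.
Qed.
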